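(* Let $p\geqslant 2$ be an integer and put $u=e^{2\pi i/3p}$. Let $R_1,R_2,R_3\in \mathrm{SU}(2,1)$ be complex reflections of order $p$ (through angle $2\pi/p$, with the normalization given in the context) in complex geodesics $C_1,C_2,C_3$ respectively of complex hyperbolic $2$-space. Assume that there is $S\in \mathrm{SU}(2,1)$ such that $$SR_1S^{-1}=R_1R_2R_1^{-1},\qquad SR_2S^{-1}=R_1R_3R_1R_3^{-1}R_1^{-1},\qquad SR_3S^{-1}=R_1R_3R_1^{-1},$$ $$S^2=R_1R_2R_3.$$ Let $m,n\geqslant 3$ be integers and suppose that $\mathrm{br}(R_1,R_3)=n$ and $\mathrm{br}(R_1,R_2)=m$, where these braiding conditions are understood in the normalized sense $$\operatorname{tr}(R_1R_2)=u\bigl(2-4\cos^2(\pi/m)\bigr)+\bar u^2,\qquad \operatorname{tr}(R_1R_3)=u\bigl(2-4\cos^2(\pi/n)\bigr)+\bar u^2.$$ Suppose also that $R_1R_2R_3$ is of finite order. Then $(n,m)$ is one of $$(3,4),\quad (3,5),\quad (4,3),\quad (5,4),\quad (8,6),\quad\text{or } (k,k)\ \text{for some integer } k\geqslant 3.$$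
   Context: $\mathbb{C}^{2,1}$ denotes $\mathbb{C}^3$ with the Hermitian form $\langle \mathbf z,\mathbf w\rangle=z_1\bar w_1+z_2\bar w_2-z_3\bar w_3$ of signature $(2,1)$; complex hyperbolic $2$-space is the projectivization of the set of negative vectors ($\langle \mathbf z,\mathbf z\rangle<0$). $\mathrm{SU}(2,1)$ is the group of determinant-one linear maps preserving the form. A complex geodesic $C$ is determined by a positive vector $\mathbf v$ (a polar vector, $\langle \mathbf v,\mathbf v\rangle>0$): $C$ is the set of points of complex hyperbolic space whose lifts are orthogonal to $\mathbf v$. The complex reflection of order $p$ (angle $\phi=2\pi/p$) in the complex geodesic $C_j$ with polar vector $\mathbf v_j$ is the map $\mathbf z\mapsto \mathbf z+(e^{i\phi}-1)\frac{\langle \mathbf z,\mathbf v_j\rangle}{\langle \mathbf v_j,\mathbf v_j\rangle}\mathbf v_j$; it is lifted to the element $R_j\in\mathrm{SU}(2,1)$ obtained by multiplying this map by $e^{-i\phi/3}=\bar u$. So $R_j\mathbf v_j=u^2\mathbf v_j$ and $R_j$ acts as $\bar u$ on $\mathbf v_j^\perp$. Braid length: elements $g,h$ of a group satisfy a braid relation of length $l\in\mathbb{Z}_{+}$ if $(gh)^{l/2}=(hg)^{l/2}$, where $(gh)^{l/2}$ denotes the alternating product of $g$ and $h$ with $l$ factors starting with $g$ (e.g. $(gh)^{3/2}=ghg$, $(hg)^2=hghg$). $\mathrm{br}(g,h)$ is the minimum length of a braid relation satisfied by $g$ and $h$. *)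

(* Defs.v *)
From mathcomp Require Import all_boot all_order all_algebra.
From mathcomp Require Import all_classical all_reals all_analysis.
From mathcomp Require Import complex.

Set Implicit Arguments.
Unset Strict Implicit.
Unset Printing Implicit Defensive.
Import Order.TTheory GRing.Theory Num.Theory.
Local Open Scope classical_set_scope.
Local Open Scope ring_scope.
Local Open Scope complex_scope.

Definition cexp (R : realType) (t : R) : R[i] := cos t +i* sin t.

(* Vectors of C^{2,1} are columns; the coordinates z_1, z_2, z_3 have the
   indices ord0, 1 and ord_max of 'I_3. *)
Definition herm (R : realType) (z w : 'cV[R[i]]_3) : R[i] :=
  z ord0 0 * (w ord0 0)^* + z 1 0 * (w 1 0)^* - z ord_max 0 * (w ord_max 0)^*.

Definition SU21 (R : realType) : set 'M[R[i]]_3 :=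
  [set A | \det A = 1 /\ forall z w, herm (A *m z) (A *m w) = herm z w].

(* On R[i], x < 0 and 0 < x include the condition that x is real. *)
Definition negative (R : realType) (z : 'cV[R[i]]_3) := herm z z < 0.
Definition polar (R : realType) (v : 'cV[R[i]]_3) := 0 < herm v v.

(* A subset of the complex hyperbolic plane is represented by the set of all
   lifts of its points. *)
Definition complex_geodesic (R : realType) (v : 'cV[R[i]]_3) :
  set 'cV[R[i]]_3 := [set z | negative z /\ herm z v = 0].

(* The complex reflection through the angle phi in the complex geodesic with
   polar vector v, as a map on C^{2,1}, before normalization to SU(2,1). *)
Definition creflection (R : realType) (phi : R) (v z : 'cV[R[i]]_3) :
  'cV[R[i]]_3 := z + ((cexp phi - 1) * (herm z v / herm v v)) *: v.

(* A is the normalized lift to SU(2,1) of the complex reflection of order p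
   (through the angle 2 pi / p) in the complex geodesic C. *)
Definition is_creflection (R : realType) (p : nat) (C : set 'cV[R[i]]_3)
    (A : 'M[R[i]]_3) : Prop :=
  exists v : 'cV[R[i]]_3,
    [/\ polar v, C = complex_geodesic v
      & forall z, A *m z =
          cexp (- (2 * pi / p%:R / 3)) *: creflection (2 * pi / p%:R) v z].

(* The product g h g ... with l factors. *)
Fixpoint altprod (T : nzRingType) (g h : T) (l : nat) : T :=
  if l is l'.+1 then g * altprod h g l' else 1.

Definition braid_rel (T : nzRingType) (g h : T) (l : nat) : Prop :=
  altprod g h l = altprod h g l.

(* br(g, h) = n; as a relation because br(g, h) need not exist. *)
Definition br (T : nzRingType) (g h : T) (n : nat) : Prop :=
  [/\ (0 < n)%N, braid_rel g h n
    & forall l, (0 < l)%N -> braid_rel g h l -> (n <= l)%N].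

(* The trace of a product of two reflections, with u = e^{2 pi i / 3p}, that
   normalizes the condition br = n. *)
Definition braid_trace (R : realType) (p n : nat) : R[i] :=
  let u := cexp (2 * pi / (3 * p%:R) : R) in
  u * (2 - 4 * cos (pi / n%:R) ^+ 2)%:C + (u^*) ^+ 2.

Definition normalized_br (R : realType) (p : nat) (A B : 'M[R[i]]_3)
    (n : nat) : Prop :=
  br A B n /\ \tr (A * B) = braid_trace R p n.

Definition finite_order (T : nzRingType) (g : T) : Prop :=
  exists2 k, (0 < k)%N & g ^+ k = 1.

(* Main.v *)
From Stdlib Require Import ZArith Znumtheory.
Require Import Defs.
From mathcomp Require Import all_boot all_order all_algebra all_field.
From mathcomp Require Import all_classical all_reals all_analysis.
From mathcomp Require Import complex.
From mathcomp Require Import ring lra zify ssrZ.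

Set Implicit Arguments.
Unset Strict Implicit.
Unset Printing Implicit Defensive.
Import Order.TTheory GRing.Theory Num.Theory.
Local Open Scope ring_scope.

(** Put T = R1^-1 S. The relations imposed on S amount to T^2 = R3 and
T R1 T^-1 = R2, so that the configuration is a reflection R1 together with a
square root T of the reflection R3 = u^-1 (1 + (u^3 - 1) P3), where P3 is the
projection onto the polar vector. The eigenvalues of T have modulus one, hence
Cayley and Hamilton give T^3 - (tr T) T^2 + (tr T)^* T - 1 = 0, and comparing
with T^2 = R3 leaves two cases. Either tr T = - u, or T is itself a scaled
reflection u P3 + g (1 - P3) with g^2 = u^-1. Encode the two braid conditions
as X = 4 cos^2(pi/n) and Y = 4 cos^2(pi/m). In the first case tau = tr S
satisfies tau + tau^* = X - 2 and |1 + tau|^2 = Y. In the second, g^3 is an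
eigenvalue of S, and changing the signs of the other two eigenvalues gives a
triple with the same two properties ([unitary_traces]). As S has finite order
this produces roots of unity z1, z2, z3 with z1 z2 z3 = 1,

  z1 + z1^-1 + z2 + z2^-1 + z3 + z3^-1 = 2 cos(2 pi/n),
  |1 + z1 + z2 + z3|^2 = 2 + 2 cos(2 pi/m).

What remains is arithmetic ([braid_pair_classification]). The first equation is
a vanishing sum of eight N-th roots of unity. For q dividing N, averaging its
conjugates under zeta -> zeta^(1 + (N/q) k) sorts the terms by the residue mod
q of their exponents ([expsum_class]): every residue class has sum zero when q^2
divides N, or when q is prime and some class is empty. The residues a1, a2, a3
of the z_i satisfy a1 + a2 + a3 = 0, and for odd q this leaves so few ways of
distributing the eight terms that either the solution is degenerate or all
exponents are divisible by q ([degenerate_classes]); for q = 2 the residues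
mod 4 are used as well ([reduce_16]). Degenerate means that two
of the z_i cancel, which gives n = m, or that z1 + z2 + z3 = 0, which gives
(4, 3). Descending on N, every other solution has order dividing 120 or 42
([cos_relation_torsion]). Then m divides 120 or 84 ([cos_in_cyclotomic]), and
finitely many triples remain. They are examined in a quotient ring of Z: an
integer polynomial that vanishes at a primitive N-th root of unity is a
multiple of the cyclotomic polynomial, so its value at 2 is divisible by
Phi_N(2) ([horner_modulus]). *)

(** * Conjugation of integer relations between roots of unity *)

Lemma root_Cyclotomic (F : idomainType) n (z : F) :
  n.-primitive_root z -> root (map_poly intr 'Phi_n) z.
Proof.
move=> prim_z; have n_gt0 := prim_order_gt0 prim_z.
have mapXn d : (map_poly intr ('X^d - 1) : {poly F}) = 'X^d - 1.
  by rewrite rmorphB /= map_polyXn rmorph1.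
have rootXn d : root (map_poly intr ('X^d - 1) : {poly F}) z = (z ^+ d == 1).
  by rewrite mapXn rootE !hornerE subr_eq0.
have : root (map_poly intr ('X^n - 1) : {poly F}) z.
  by rewrite rootXn prim_expr_order.
rewrite -prod_Cyclotomic // rmorph_prod /= rootE horner_prod prodf_seq_eq0.
case/hasP=> d; rewrite -dvdn_divisors // => dvd_dn /= rootd.
have d_gt0 := dvdn_gt0 n_gt0 dvd_dn.
suff /eqP zd1 : z ^+ d == 1.
  have /eqP <- : d == n by rewrite eqn_dvd dvd_dn (prim_order_dvd prim_z) zd1 eqxx.
  by [].
rewrite -rootXn -prod_Cyclotomic // rmorph_prod /= rootE horner_prod.
rewrite prodf_seq_eq0; apply/hasP; exists d => //.
by rewrite -dvdn_divisors.
Qed.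

(** Irreducibility of the cyclotomic polynomial is available over the algebraic
numbers: the rational gcd of p and Phi_n is not constant, since z is a common
root, so it has an algebraic root, which is a primitive n-th root of unity with
minimal polynomial Phi_n. Division by a monic polynomial stays integral. *)
Lemma Cyclotomic_factor (K : numFieldType) n (z : K) (p : {poly int}) :
  n.-primitive_root z -> root (map_poly intr p) z ->
  exists q : {poly int}, p = q * 'Phi_n.
Proof.
move=> prim_z root_p.
pose pQ : {poly rat} := map_poly intr p.
pose PhiQ : {poly rat} := map_poly intr 'Phi_n.
have ratr_int (F : numFieldType) (q : {poly int}) :
    map_poly (ratr : rat -> F) (map_poly intr q) = map_poly intr q.
  by rewrite -map_poly_comp; apply: eq_map_poly => a /=; rewrite rmorph_int.
have [y root_y] : exists y : algC, root (map_poly ratr (gcdp pQ PhiQ)) y.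
  apply/closed_rootP; rewrite size_map_poly -(size_map_poly (ratr : rat -> K)).
  apply/eqP => /eqP/size_poly1P[c c0] /(congr1 (fun q => root q z)).
  by rewrite gcdp_map !ratr_int root_gcd root_p root_Cyclotomic // rootC (negPf c0).
move: root_y; rewrite gcdp_map !ratr_int root_gcd => /andP[root_py root_y].
have [y0 prim_y0] := C_prim_root_exists (prim_order_gt0 prim_z).
have prim_y : n.-primitive_root y.
  by rewrite -(root_cyclotomic prim_y0) -(Cintr_Cyclotomic prim_y0).
have dvdQ : PhiQ %| pQ.
  have [q [def_q _] dvd_q] := minCpolyP y.
  rewrite (_ : PhiQ = q) -?dvd_q ?ratr_int //.
  apply: (map_poly_inj (ratr : rat -> algC)).
  by rewrite ratr_int -def_q (minCpoly_cyclotomic prim_y) (Cintr_Cyclotomic prim_y).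
have : 'Phi_n %| p by rewrite -dvdp_rat_int.
by case/Pdiv.IdomainMonic.dvdpP => [|q ->]; [exact: Cyclotomic_monic|exists q].
Qed.

(** Relations are stored as lists of coefficient and exponent, so that a
residue class of exponents is selected by [filter]. *)
Definition expsum (R : nzRingType) (z : R) (l : seq (int * nat)) : R :=
  \sum_(x <- l) x.1%:~R * z ^+ x.2.

Lemma expsum_primitive_root (K : numFieldType) (L : idomainType) n
    (z : K) (g : L) (l : seq (int * nat)) :
  n.-primitive_root z -> n.-primitive_root g -> expsum z l = 0 -> expsum g l = 0.
Proof.
move=> prim_z prim_g.
have expsumE (F : idomainType) (x : F) :
    expsum x l = (map_poly intr (\sum_(y <- l) y.1 *: 'X^(y.2)) : {poly F}).[x].
  rewrite rmorph_sum horner_sum; apply: eq_bigr => y _ /=.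
  by rewrite map_polyZ map_polyXn !hornerE.
rewrite !expsumE => /rootP/(Cyclotomic_factor prim_z)[q ->].
by rewrite rmorphM hornerM (rootP (root_Cyclotomic prim_g)) mulr0.
Qed.

Lemma sum_expr_unity_root (K : fieldType) q (e : K) :
  e ^+ q = 1 -> \sum_(k < q) e ^+ k = if e == 1 then q%:R else 0.
Proof.
move=> eq1; case: eqP => [->|/eqP ne1].
  by under eq_bigr do rewrite expr1n; rewrite sumr_const card_ord.
apply/eqP; move/eqP: (subrX1 e q); rewrite eq1 subrr eq_sym mulf_eq0.
by rewrite subr_eq0 (negPf ne1).
Qed.

(** Orthogonality of characters: with n = z^M of order q, averaging
n^(-r k) times the conjugate of the relation under z -> z^(1 + M k) over
k < q keeps exactly the exponents congruent to r. The exponent 1 + M k is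
coprime to q M for all k with at most one exception k0, whose contribution
n^(-r k0) f is what prevents the class sums from vanishing. *)
Lemma expsum_class (K : numFieldType) (q M : nat) (z : K) (l : seq (int * nat)) :
  (0 < q)%N -> (q * M).-primitive_root z ->
  (forall k1 k2, (k1 < q)%N -> (k2 < q)%N -> ~~ coprime (1 + M * k1) (q * M) ->
     ~~ coprime (1 + M * k2) (q * M) -> k1 = k2) ->
  expsum z l = 0 ->
  exists w f : K, [/\ w ^+ q = 1,
    (forall k, (k < q)%N -> coprime (1 + M * k) (q * M)) -> f = 0
  & forall r, expsum z [seq x <- l | x.2 == r %[mod q]] = w ^+ r * f].
Proof.
move=> q_gt0 prim_z uniq_k lz0.
have z_neq0 : z != 0 by rewrite (prim_root_eq0 prim_z) -lt0n (prim_order_gt0 prim_z).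
have conj0 k : coprime (1 + M * k) (q * M) -> expsum (z ^+ (1 + M * k)) l = 0.
  move=> cop; apply: (expsum_primitive_root prim_z _ lz0).
  by rewrite prim_root_exp_coprime.
have [k0 k0P] : exists k0 : 'I_q, forall k : 'I_q, k != k0 ->
    coprime (1 + M * k) (q * M).
  case: (pickP [pred k : 'I_q | ~~ coprime (1 + M * k) (q * M)]) => [k0 /= k0P|cop].
    exists k0 => k; apply: contraNT => kP.
    by apply/eqP/val_inj/(uniq_k _ _ (ltn_ord k) (ltn_ord k0)).
  by exists (Ordinal q_gt0) => k _; have /= /negbFE := cop k.
pose n := z ^+ M.
have nq1 : n ^+ q = 1 by rewrite -exprM mulnC (prim_expr_order prim_z).
have n_neq0 : n != 0 by rewrite expf_neq0.
have q_neq0 : q%:R != 0 :> K by rewrite pnatr_eq0 -lt0n.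
exists ((n ^+ k0)^-1), (expsum (z ^+ (1 + M * k0)) l / q%:R); split.
- by rewrite exprVn exprAC nq1 expr1n invr1.
- by move=> /(_ k0 (ltn_ord _)) /conj0 ->; rewrite mul0r.
move=> r.
have projE (x : int * nat) :
    (x.2 == r %[mod q])%:R * z ^+ x.2 * q%:R =
    \sum_(k < q) (n ^+ k)^-1 ^+ r * (z ^+ (1 + M * k)) ^+ x.2.
  have -> : \sum_(k < q) (n ^+ k)^-1 ^+ r * (z ^+ (1 + M * k)) ^+ x.2 =
      z ^+ x.2 * \sum_(k < q) (n ^+ x.2 / n ^+ r) ^+ k.
    rewrite big_distrr; apply: eq_bigr => k _ /=.
    rewrite exprD expr1 exprM -/n [(z * _) ^+ _]exprMn [(n ^+ x.2 / _) ^+ _]exprMn.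
    by rewrite !exprVn [n ^+ k ^+ r]exprAC [n ^+ k ^+ x.2]exprAC mulrCA [_ * n ^+ x.2 ^+ k]mulrC.
  rewrite sum_expr_unity_root; last first.
    by rewrite exprMn exprVn -!exprM ![(_ * q)%N]mulnC !exprM nq1 !expr1n divr1.
  have prim_n : q.-primitive_root n.
    have := dvdn_prim_root prim_z (dvdn_mulr M (dvdnn q)).
    by rewrite mulKn.
  rewrite -(eq_prim_root_expr prim_n)
    -[n ^+ x.2 == _](inj_eq (mulIf (invr_neq0 (expf_neq0 r n_neq0)))).
  rewrite divff ?expf_neq0 //.
  by case: eqP => _; rewrite ?mul1r ?mul0r ?mulr0.
apply: (mulIf q_neq0); rewrite -mulrA divfK //.
rewrite {1}/expsum big_filter big_mkcond /= mulr_suml.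
transitivity (\sum_(k < q) (n ^+ k)^-1 ^+ r * expsum (z ^+ (1 + M * k)) l).
  under [RHS]eq_bigr do rewrite /expsum mulr_sumr.
  rewrite exchange_big /=; apply: eq_bigr => x _.
  under eq_bigr do rewrite mulrCA.
  rewrite -mulr_sumr -projE.
  by case: eqP => _; rewrite /= ?mul0r ?mulr0 ?mul1r ?mulrA.
rewrite (bigD1 k0) //= big1 ?addr0 // => k /k0P /conj0 ->; exact: mulr0.
Qed.

(** * Distribution of the eight terms into classes *)

Definition cos_relation (K : fieldType) (z1 z2 z3 t : K) : Prop :=
  [/\ t != 0, z1 * z2 * z3 = 1 &
   z1 + z1^-1 + (z2 + z2^-1) + (z3 + z3^-1) = t + t^-1].

(** The last alternative records the inverses too: they sum to the complex
conjugate, which an abstract field does not see. *)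
Definition degenerate (K : fieldType) (z1 z2 z3 t : K) : Prop :=
  [\/ t = -1, (z1 + z2) * (z1 + z3) * (z2 + z3) = 0
   | z1 + z2 + z3 = 0 /\ z1^-1 + z2^-1 + z3^-1 = 0].

(** Inversion of roots of unity acts on the classes as - . *)
Definition class_part (G : zmodType) (K : fieldType) (a : G) (z : K) (r : G) : K :=
  z *+ (a == r) + z^-1 *+ (- a == r).

Definition class_relation (G : zmodType) (K : fieldType) (z1 z2 z3 t : K)
    (a1 a2 a3 b : G) : Prop :=
  a1 + a2 + a3 = 0 /\
  forall r : G, class_part a1 z1 r + class_part a2 z2 r + class_part a3 z3 r =
    class_part b t r.

Section CosRelation.
Variable K : numFieldType.
Implicit Types z s t : K.

Lemma prod3_neq0 z1 z2 z3 :
  z1 * z2 * z3 = 1 -> [/\ z1 != 0, z2 != 0 & z3 != 0].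
Proof.
move=> p; have : z1 * z2 * z3 != 0 by rewrite p oner_neq0.
by rewrite !mulf_eq0 !negb_or -andbA => /and3P.
Qed.

Lemma cos_relation12 z1 z2 z3 t :
  cos_relation z1 z2 z3 t -> cos_relation z2 z1 z3 t.
Proof. by case=> t0 p e; split=> //; [rewrite -p|rewrite -e]; ring. Qed.

Lemma cos_relation13 z1 z2 z3 t :
  cos_relation z1 z2 z3 t -> cos_relation z3 z2 z1 t.
Proof. by case=> t0 p e; split=> //; [rewrite -p|rewrite -e]; ring. Qed.

Lemma degenerate12 z1 z2 z3 t : degenerate z1 z2 z3 t -> degenerate z2 z1 z3 t.
Proof.
case=> [->|e|[e e']]; first by apply: Or31.
  by apply: Or32; rewrite -e; ring.
by apply: Or33; split; [rewrite -e|rewrite -e']; ring.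
Qed.

Lemma degenerate13 z1 z2 z3 t : degenerate z1 z2 z3 t -> degenerate z3 z2 z1 t.
Proof.
case=> [->|e|[e e']]; first by apply: Or31.
  by apply: Or32; rewrite -e; ring.
by apply: Or33; split; [rewrite -e|rewrite -e']; ring.
Qed.

Lemma inv_sum_eqN2 t : t != 0 -> t + t^-1 = -2 -> t = -1.
Proof.
move=> t0 e; apply/eqP; rewrite -addr_eq0; suff: (t + 1) ^+ 2 == 0 by rewrite sqrf_eq0.
have -> : (t + 1) ^+ 2 = t * (t + t^-1 + 2) by field.
by rewrite e addNr mulr0.
Qed.

(** The sum factors as (z2 + z3) (1 + z2 z3) / (z2 z3), and z2 z3 = -1 means
z1 = -1, hence t + t^-1 = -2. *)
Lemma degenerate_pair z1 z2 z3 t : cos_relation z1 z2 z3 t ->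
  z2 + z2^-1 + (z3 + z3^-1) = 0 -> degenerate z1 z2 z3 t.
Proof.
case=> t0 p e e0; have [z10 z20 z30] := prod3_neq0 p.
have /eqP : (z2 + z3) * (1 + z2 * z3) = 0.
  have -> : (z2 + z3) * (1 + z2 * z3) = z2 * z3 * (z2 + z2^-1 + (z3 + z3^-1)).
    by field; rewrite z20 z30.
  by rewrite e0 mulr0.
rewrite mulf_eq0 => /orP[/eqP e1|]; first by apply: Or32; rewrite e1 mulr0.
rewrite addrC addr_eq0 => /eqP e1.
have z1N1 : z1 = -1 by rewrite -p -mulrA e1 mulrN1 opprK.
apply: Or31; apply: inv_sum_eqN2 => //.
by rewrite -e z1N1 -addrA e0 invrN1 addr0; ring.
Qed.

(** Equality would make z2 z3 a primitive cube root of unity, while z1^2 = -1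
makes it a fourth root of unity. *)
Lemma cos_relation_noncube z1 z2 z3 s : z1 * z2 * z3 = 1 -> s != 0 ->
  z1 + z1^-1 = 0 -> z2 + z3^-1 = s -> z2^-1 + z3 <> s^-1.
Proof.
move=> p s0 e1 e2 e3; have [z10 z20 z30] := prod3_neq0 p.
have : (z2 + z3^-1) * (z2^-1 + z3) = 1 by rewrite e2 e3 divff.
have e4 : z2 * z3 = z1^-1 by apply: (mulfI z10); rewrite mulrA p divff.
have -> : (z2 + z3^-1) * (z2^-1 + z3) = 2 + z2 * z3 + (z2 * z3)^-1.
  by field; rewrite z20 z30.
rewrite e4 invrK -addrA [_ + z1]addrC e1 addr0 => /eqP.
by rewrite -subr_eq0 addrK oner_eq0.
Qed.

(** A sum z1 + z2 + z3 of modulus one is one of the z_i: since the inverses sum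
to s^-1, the polynomial with roots z1, z2, z3 vanishes at s. *)
Lemma degenerate_sum_unit z1 z2 z3 s t : s != 0 ->
  z1 * z2 * z3 = 1 -> z1 + z2 + z3 = s -> z1^-1 + z2^-1 + z3^-1 = s^-1 ->
  degenerate z1 z2 z3 t.
Proof.
move=> s0 p e1 e2; have [z10 z20 z30] := prod3_neq0 p; apply: Or32.
have e3 : z1^-1 + z2^-1 + z3^-1 = z2 * z3 + z1 * z3 + z1 * z2.
  by rewrite -[LHS]mul1r -p; field; rewrite z10 z20 z30.
have -> : (z1 + z2) * (z1 + z3) * (z2 + z3) =
  (z1 + z2 + z3) * (z2 * z3 + z1 * z3 + z1 * z2) - z1 * z2 * z3 by ring.
by rewrite -e3 e1 e2 p divff // subrr.
Qed.

Section Classes.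
Variable G : zmodType.
Implicit Types a b r : G.

Lemma class_partN a z r : class_part a z (- r) = class_part a z^-1 r.
Proof. by rewrite /class_part invrK eqr_opp eqr_oppLR addrC. Qed.

Lemma class_part0 z r : r != 0 -> class_part 0 z r = 0.
Proof. by rewrite /class_part oppr0 eq_sym => /negPf ->; rewrite addr0. Qed.

Lemma class_part00 z : class_part (0 : G) z 0 = z + z^-1.
Proof. by rewrite /class_part oppr0 eqxx. Qed.

Lemma class_part_id a z : - a != a -> class_part a z a = z.
Proof. by rewrite /class_part eqxx => /negPf ->; rewrite addr0. Qed.

Lemma class_part_opp a z : - a != a -> class_part (- a) z a = z^-1.
Proof. by rewrite /class_part opprK eqxx => /negPf ->; rewrite add0r. Qed.

Lemma class_part_out a z r : a != r -> - a != r -> class_part a z r = 0.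
Proof. by rewrite /class_part => /negPf -> /negPf ->; rewrite addr0. Qed.

Lemma class_partP b t r : - r != r ->
  [\/ class_part b t r = 0 /\ class_part b t (- r) = 0,
      b = r /\ (class_part b t r = t /\ class_part b t (- r) = t^-1)
    | b = - r /\ (class_part b t r = t^-1 /\ class_part b t (- r) = t)].
Proof.
move=> r2; rewrite class_partN; have [->|br] := eqVneq b r.
  by apply: Or32; rewrite !class_part_id.
have [->|bNr] := eqVneq b (- r).
  by apply: Or33; rewrite !class_part_opp // invrK.
by apply: Or31; rewrite !class_part_out // eqr_oppLR.
Qed.

Lemma class_relation12 z1 z2 z3 t a1 a2 a3 b :
  class_relation z1 z2 z3 t a1 a2 a3 b -> class_relation z2 z1 z3 t a2 a1 a3 b.
Proof.
by case=> s e; split=> [|r]; [rewrite [a2 + _]addrC | rewrite [class_part a2 _ _ + _]addrC].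
Qed.

Lemma class_relation13 z1 z2 z3 t a1 a2 a3 b :
  class_relation z1 z2 z3 t a1 a2 a3 b -> class_relation z3 z2 z1 t a3 a2 a1 b.
Proof.
by case=> s e; split=> [|r]; rewrite [LHS]addrC addrA [in LHS]addrAC ?s // -e addrAC.
Qed.

(** Here the classes are 0, a2 and - a2. In the class of z2 only z3^-1 and one
of t, t^-1 can occur; the latter would leave z1 + z1^-1 alone in the class 0. *)
Lemma degenerate_class0 z1 z2 z3 t a2 a3 b : - a2 != a2 ->
  cos_relation z1 z2 z3 t -> class_relation z1 z2 z3 t 0 a2 a3 b ->
  degenerate z1 z2 z3 t.
Proof.
move=> a2N rel [s e]; have [t0 p _] := rel.
have a20 : a2 != 0 by apply: contraNneq a2N => ->; rewrite oppr0.
have a3E : a3 = - a2 by apply/eqP; rewrite -addr_eq0 addrC -[a2]add0r s.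
have := e a2; have := e (- a2); have := e 0.
rewrite a3E [class_part a2 z2 (- a2)]class_partN [class_part (- a2) z3 (- a2)]class_partN.
rewrite class_part00 ![class_part 0 _ _]class_part0 ?oppr_eq0 // !add0r.
rewrite [class_part a2 _ 0]class_part_out ?[class_part (- a2) _ 0]class_part_out
  ?oppr_eq0 ?opprK //.
rewrite !class_part_opp // !class_part_id // invrK !addr0 => e0.
have [[-> ->]|[bE [-> ->]]|[bE [-> ->]]] := class_partP b t a2N => em ep.
- by apply: degenerate_pair rel _; rewrite [z3 + _]addrC addrACA ep em addr0.
- by case: (cos_relation_noncube p t0 _ ep em); rewrite e0 bE class_part_out ?oppr_eq0.
- case: (@cos_relation_noncube _ _ _ t^-1 p _ _ ep); rewrite ?invrK ?invr_eq0 //.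
  by rewrite e0 bE class_part_out ?opprK ?oppr_eq0.
Qed.

(** Satisfied by the cyclic groups of odd order. *)
Hypothesis G2 : forall a, - a = a -> a = 0.

Let oppN a : a != 0 -> - a != a.
Proof. by apply: contra_neq => /G2. Qed.

(** If no other z_i or z_i^-1 shares the class of z3, then z3 is t or t^-1, and
the other two cosines cancel. *)
Lemma degenerate_lone z1 z2 z3 t a1 a2 a3 b :
  cos_relation z1 z2 z3 t -> class_relation z1 z2 z3 t a1 a2 a3 b ->
  a1 != 0 -> a2 != 0 -> a3 != 0 -> a1 != a3 -> a2 != a3 ->
  degenerate z1 z2 z3 t.
Proof.
move=> rel [s e] a10 a20 a30 a13 a23; have [t0 p e0] := rel.
have [z10 z20 z30] := prod3_neq0 p.
have a13N : - a1 != a3.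
  by rewrite eqr_oppLR; apply: contra_neq a20 => a1E; rewrite -s a1E addrAC addNr add0r.
have a23N : - a2 != a3.
  by rewrite eqr_oppLR; apply: contra_neq a10 => a2E; rewrite -s a2E subrK.
have := e a3; rewrite [class_part a3 _ _]class_part_id ?oppN //.
rewrite [class_part a1 _ _]class_part_out // [class_part a2 _ _]class_part_out // !add0r.
have z3t : z3 + z3^-1 = t + t^-1 -> degenerate z1 z2 z3 t.
  move=> e3; apply: degenerate13; apply: degenerate_pair; first exact: cos_relation13.
  apply: (addIr (t + t^-1)); rewrite add0r -{1}e3 -e0; ring.
have [[-> _]|[_ [-> _]]|[_ [-> _]]] := class_partP b t (oppN a30) => ez3.
- by rewrite ez3 eqxx in z30.
- by apply: z3t; rewrite ez3.
- by apply: z3t; rewrite ez3 invrK addrC.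
Qed.

(** If no class is zero and none of the z_i is alone in its class, all three
classes agree, and z1 + z2 + z3 is 0, t or t^-1. *)
Theorem degenerate_classes z1 z2 z3 t a1 a2 a3 b :
  cos_relation z1 z2 z3 t -> class_relation z1 z2 z3 t a1 a2 a3 b ->
  degenerate z1 z2 z3 t \/ [/\ a1 = 0, a2 = 0, a3 = 0 & b = 0].
Proof.
move=> rel crel; have [t0 p e0] := rel; have [s e] := crel.
have case0 y1 y2 y3 c1 c2 c3 : cos_relation y1 y2 y3 t ->
    class_relation y1 y2 y3 t c1 c2 c3 b -> c1 = 0 ->
    degenerate y1 y2 y3 t \/ [/\ c1 = 0, c2 = 0, c3 = 0 & b = 0].
  move=> yrel ycrel c10; move: ycrel; rewrite c10 => ycrel.
  have [c20|c20] := eqVneq c2 0; last first.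
    by left; apply: degenerate_class0 yrel ycrel; exact: oppN.
  have [ys ye] := ycrel; have c30 : c3 = 0 by rewrite -ys c20 !add0r.
  right; split=> //; apply/eqP; apply: contraT => b0; have := ye b.
  rewrite c20 c30 !class_part0 // class_part_id ?oppN // !addr0 => tE.
  by rewrite -tE eqxx in t0.
have [a10|a10] := eqVneq a1 0; first exact: case0.
have [a20|a20] := eqVneq a2 0.
  have [|D|[]] := @case0 _ _ _ _ _ _ (cos_relation12 rel) (class_relation12 crel) => //.
    by left; exact: degenerate12.
  by right.
have [a30|a30] := eqVneq a3 0.
  have [|D|[]] := @case0 _ _ _ _ _ _ (cos_relation13 rel) (class_relation13 crel) => //.
    by left; exact: degenerate13.
  by right.
left; have [a13|a13] := eqVneq a1 a3; have [a23|a23] := eqVneq a2 a3.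
- have := e a3; have := e (- a3).
  rewrite a13 a23 ![class_part a3 _ (- a3)]class_partN ![class_part a3 _ a3]class_part_id ?oppN //.
  have [[-> ->]|[_ [-> ->]]|[_ [-> ->]]] := class_partP b t (oppN a30) => em ep.
  + exact: Or33.
  + exact: (degenerate_sum_unit t t0 p ep em).
  + by apply: (degenerate_sum_unit t (invr_neq0 t0) p ep); rewrite invrK.
- apply/degenerate12/degenerate13.
  apply: (degenerate_lone (cos_relation13 (cos_relation12 rel))
    (class_relation13 (class_relation12 crel))) => //; last by rewrite a13 eq_sym.
  by rewrite eq_sym.
- apply: degenerate13.
  apply: (degenerate_lone (cos_relation13 rel) (class_relation13 crel)) => //.
    by rewrite eq_sym.
  by rewrite a23 eq_sym.
- exact: degenerate_lone rel crel _ _ _ _ _.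
Qed.
End Classes.
End CosRelation.

(** * Descent on the common order *)

Lemma eq_Zp_nat q (e : nat) (r : 'Z_q) : (1 < q)%N ->
  (e%:R == r) = (e == r %[mod q]).
Proof.
move=> q1; rewrite -val_eqE /= val_Zp_nat // [X in _ = (_ == X)]modn_small //.
by rewrite -[X in (_ < X)%N](Zp_cast q1).
Qed.

(** The case of [expsum_class] for a cosine relation. Classes are taken in 'Z_q,
where the vanishing of i1 + i2 + i3 expresses z1 z2 z3 = 1. *)
Lemma class_equation (K : numFieldType) q M (z : K) i1 i2 i3 j :
  (1 < q)%N -> (q * M).-primitive_root z ->
  (forall k1 k2, (k1 < q)%N -> (k2 < q)%N -> ~~ coprime (1 + M * k1) (q * M) ->
     ~~ coprime (1 + M * k2) (q * M) -> k1 = k2) ->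
  cos_relation (z ^+ i1) (z ^+ i2) (z ^+ i3) (z ^+ j) ->
  i1%:R + i2%:R + i3%:R = 0 :> 'Z_q /\
  exists w f : K, [/\ w ^+ q = 1,
    (forall k, (k < q)%N -> coprime (1 + M * k) (q * M)) -> f = 0
  & forall r : 'Z_q, class_part i1%:R (z ^+ i1) r + class_part i2%:R (z ^+ i2) r
     + class_part i3%:R (z ^+ i3) r - class_part j%:R (z ^+ j) r = w ^+ r * f].
Proof.
move=> q1 prim_z cop [t0 p e]; have q0 := ltnW q1.
have N_gt0 := prim_order_gt0 prim_z.
split.
  move/eqP: p; rewrite -!exprD -(prim_order_dvd prim_z) -!natrD.
  move/(dvdn_trans (dvdn_mulr _ (dvdnn q)))/dvdnP => [k ->].
  by rewrite natrM char_Zp // mulr0.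
pose N := (q * M)%N.
have inv_z i : z ^+ (N.-1 * i) = (z ^+ i)^-1.
  have zu : z ^+ i != 0.
    by rewrite expf_neq0 // (prim_root_eq0 prim_z) -lt0n.
  apply: (mulIf zu); rewrite mulVf // -exprD addnC -mulSn prednK // exprM.
  by rewrite (prim_expr_order prim_z) ?expr1n.
pose l : seq (int * nat) :=
  [:: (1, i1); (1, (N.-1 * i1)%N); (1, i2); (1, (N.-1 * i2)%N);
      (1, i3); (1, (N.-1 * i3)%N); (-1, j); (-1, (N.-1 * j)%N)].
have l0 : expsum z l = 0.
  rewrite /expsum !big_cons big_nil /= !inv_z !(mul1r, mulN1r, rmorphN1) addr0.
  by rewrite -opprD !addrA -e !addrA subrr.
have [w [f [wq f0 fE]]] := expsum_class q0 prim_z cop l0.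
exists w, f; split=> // r; rewrite -fE.
have natN i : (N.-1 * i)%:R = - i%:R :> 'Z_q.
  rewrite natrM -subn1 natrB // natrM char_Zp // mul0r sub0r mulN1r //.
rewrite /expsum big_filter big_mkcond /= !big_cons big_nil /= -!eq_Zp_nat // !natN.
rewrite !inv_z !(mul1r, mulN1r, rmorphN1) addr0 /class_part.
by rewrite -!mulrb !mulNrn opprD !addrA.
Qed.

(** Since 120 = 2^3 3 5, these are the prime powers at which the descent has to
make progress. *)
Lemma dvdn120P N : (0 < N)%N -> ~~ (N %| 120)%N ->
  [\/ (16 %| N)%N, (exists2 q, prime q & odd q && (q ^ 2 %| N)%N)
    | (exists2 q, prime q & (6 < q)%N && (q %| N)%N)].
Proof.
move=> N0 N120; have : ~~ all (fun q : nat => N`_q %| 120)%N (primes N).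
  by apply: contra N120 => /allP nP; apply/(dvdn_partP _ N0) => q /nP.
rewrite -has_predC => /hasP[q qN /= qP].
have [q_pr q_dvd] : prime q /\ (q %| N)%N.
  by move: qN; rewrite mem_primes N0 => /andP[].
have large e : (q ^ e %| 120)%N -> (q ^ e.+1 %| N)%N.
  move=> qe; rewrite pfactor_dvdn // ltnNge; apply: contra qP => le_e.
  by rewrite p_part (dvdn_trans _ qe) // dvdn_exp2l.
have [q6|] := ltnP 6 q; first by apply: Or33; exists q => //; rewrite q6.
case: q q_pr q_dvd large {qN qP} => [|[|[|[|[|[|[|q]]]]]]] // q_pr _ large _.
- by apply: Or31; exact: (large 3).
- by apply: Or32; exists 3 => //=; exact: (large 1%N).
- by apply: Or32; exists 5 => //=; exact: (large 1%N).
Qed.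

Lemma coprime_succ_mul M k : coprime (1 + M * k) M.
Proof. by rewrite /coprime addnC mulnC gcdnC gcdnMDl gcdn1. Qed.

Lemma coprime_shift q M k : prime q ->
  coprime (1 + M * k) (q * M) = ~~ (q %| 1 + M * k)%N.
Proof.
by move=> q_pr; rewrite coprimeMr coprime_succ_mul andbT coprime_sym prime_coprime.
Qed.

Lemma coprime_shift_uniq q M k1 k2 : prime q -> (k1 < q)%N -> (k2 < q)%N ->
  ~~ coprime (1 + M * k1) (q * M) -> ~~ coprime (1 + M * k2) (q * M) -> k1 = k2.
Proof.
move=> q_pr; wlog le12 : k1 k2 / (k1 <= k2)%N.
  move=> hw; have [/hw//|/ltnW/hw h] := leqP k1 k2.
  by move=> *; apply/esym/h.
rewrite !coprime_shift // !negbK => lt1 lt2 d1 d2.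
have := dvdn_sub d2 d1; rewrite subnDl -mulnBr Euclid_dvdM // => /orP[dM|].
  by move: d1; rewrite addnC dvdn_addr ?dvdn_mulr // dvdn1 => /eqP q1; rewrite q1 in q_pr.
have [->//|ne12] := eqVneq k1 k2; move/dvdn_leq; lia.
Qed.

Lemma coprime_shift_all q M : prime q -> (q %| M)%N ->
  forall k, (k < q)%N -> coprime (1 + M * k) (q * M).
Proof.
move=> q_pr qM k _; rewrite coprime_shift // addnC dvdn_addr ?dvdn_mulr //.
by rewrite dvdn1; apply: contraTneq q_pr => ->.
Qed.

Lemma Zp_nat_eq0 q (e : nat) : (1 < q)%N -> (e%:R == 0 :> 'Z_q) = (q %| e)%N.
Proof. by move=> q1; rewrite eq_Zp_nat //= mod0n. Qed.

Lemma Zp_oppr_eq q (a : 'Z_q) : (1 < q)%N -> odd q -> - a = a -> a = 0.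
Proof.
move=> q1 q_odd; rewrite -[a]natr_Zp => /eqP.
rewrite -subr_eq0 -opprD -mulr2n oppr_eq0 -mulrnA => /eqP/eqP.
by rewrite Zp_nat_eq0 // Gauss_dvdl ?coprimen2 // => qa; apply/eqP; rewrite Zp_nat_eq0.
Qed.

Section Reduction.
Variable K : numFieldType.
Implicit Types z t : K.

Definition common_torsion n z1 z2 z3 t : Prop :=
  [/\ z1 ^+ n = 1, z2 ^+ n = 1, z3 ^+ n = 1 & t ^+ n = 1].

Lemma class_relation_of q z i1 i2 i3 j (w f : K) : (1 < q)%N -> f = 0 ->
  i1%:R + i2%:R + i3%:R = 0 :> 'Z_q ->
  (forall r : 'Z_q, class_part i1%:R (z ^+ i1) r + class_part i2%:R (z ^+ i2) r
     + class_part i3%:R (z ^+ i3) r - class_part j%:R (z ^+ j) r = w ^+ r * f) ->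
  class_relation (z ^+ i1) (z ^+ i2) (z ^+ i3) (z ^+ j)
    (i1%:R : 'Z_q) i2%:R i3%:R j%:R.
Proof.
move=> q1 f0 s e; split=> // r; apply/eqP; rewrite -subr_eq0 e f0; exact/eqP/mulr0.
Qed.

Lemma dvdn_prim_expr q M z i : (0 < q)%N -> (q * M).-primitive_root z -> (q %| i)%N ->
  (z ^+ i) ^+ M = 1.
Proof.
move=> q0 prim_z /dvdnP[k ->]; rewrite -exprM -mulnA mulnC exprM.
by rewrite (prim_expr_order prim_z) expr1n.
Qed.

Lemma reduce_exponents q M z i1 i2 i3 j : (0 < q)%N -> (q * M).-primitive_root z ->
  [/\ (q %| i1)%N, (q %| i2)%N, (q %| i3)%N & (q %| j)%N] ->
  common_torsion M (z ^+ i1) (z ^+ i2) (z ^+ i3) (z ^+ j).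
Proof. by move=> q0 prim_z [*]; split; exact: dvdn_prim_expr prim_z _. Qed.

Lemma reduce_odd_square q M z i1 i2 i3 j : prime q -> odd q -> (q %| M)%N ->
  (q * M).-primitive_root z ->
  cos_relation (z ^+ i1) (z ^+ i2) (z ^+ i3) (z ^+ j) ->
  degenerate (z ^+ i1) (z ^+ i2) (z ^+ i3) (z ^+ j) \/
  common_torsion M (z ^+ i1) (z ^+ i2) (z ^+ i3) (z ^+ j).
Proof.
move=> q_pr q_odd qM prim_z rel; have q1 := prime_gt1 q_pr.
have [s [w [f [_ f0 e]]]] :=
  class_equation q1 prim_z (fun k1 k2 => @coprime_shift_uniq q M k1 k2 q_pr) rel.
have crel := class_relation_of q1 (f0 (coprime_shift_all q_pr qM)) s e.
have [|[/eqP + /eqP + /eqP + /eqP]] :=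
  degenerate_classes (fun a => @Zp_oppr_eq q a q1 q_odd) rel crel; first by left.
rewrite !Zp_nat_eq0 // => ? ? ? ?; right.
by apply: reduce_exponents prim_z _; [exact: ltnW|split].
Qed.

Lemma sub_full_card q (s : seq 'Z_q) : (1 < q)%N ->
  (forall r : 'Z_q, r \in s) -> (q <= size s)%N.
Proof.
move=> q1 full; apply: (@leq_trans #|'Z_q|); first by rewrite card_ord Zp_cast.
by rewrite cardE; apply: uniq_leq_size (enum_uniq _) _ => r _; exact: full.
Qed.

(** With a3 = - a2 the eight classes take at most five values, so for q > 5
one residue class is empty. *)
Lemma no_cover_class0 q (a2 a3 b : 'Z_q) : (5 < q)%N -> a2 + a3 = 0 ->
  ~ forall r, r \in [:: 0; - 0; a2; - a2; a3; - a3; b; - b].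
Proof.
move=> q5 /eqP; rewrite addrC addr_eq0 => /eqP -> full.
have /(leq_trans q5) // : (q <= size [:: 0%R; a2; - a2; b; - b])%N.
apply: sub_full_card => [|r]; first by do 4!apply: ltnW.
have := full r; rewrite !inE opprK oppr0.
by do 7!(case/orP; first by move=> ->; rewrite ?orbT); move=> ->; rewrite ?orbT.
Qed.

(** If all class sums vanish, [degenerate_classes] applies. Otherwise every
residue mod q is the class of one of the eight terms; this forces q = 7, t in
the class 0, and each other term alone in its class. Comparing the class sums
w^r f then gives f^2 = 1, so z_i^14 = 1 and (t + t^-1)^2 = 1. *)
Lemma reduce_large_prime q M z i1 i2 i3 j : prime q -> (6 < q)%N ->
  (q * M).-primitive_root z ->
  cos_relation (z ^+ i1) (z ^+ i2) (z ^+ i3) (z ^+ j) ->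
  [\/ degenerate (z ^+ i1) (z ^+ i2) (z ^+ i3) (z ^+ j),
     common_torsion M (z ^+ i1) (z ^+ i2) (z ^+ i3) (z ^+ j)
   | common_torsion 42 (z ^+ i1) (z ^+ i2) (z ^+ i3) (z ^+ j)].
Proof.
move=> q_pr q6 prim_z rel; have q1 := prime_gt1 q_pr.
have q_odd : odd q by case: (even_prime q_pr) q6 => [->|].
have [s [w [f [wq _ e]]]] :=
  class_equation q1 prim_z (fun k1 k2 => @coprime_shift_uniq q M k1 k2 q_pr) rel.
have [f0|f_neq0] := eqVneq f 0.
  have crel := class_relation_of q1 f0 s e.
  have [|[/eqP + /eqP + /eqP + /eqP]] :=
    degenerate_classes (fun a => @Zp_oppr_eq q a q1 q_odd) rel crel; first by apply: Or31.
  rewrite !Zp_nat_eq0 // => ? ? ? ?; apply: Or32.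
  by apply: reduce_exponents prim_z _; [exact: ltnW|split].
apply: Or33; move: s e.
set z1 := z ^+ i1; set z2 := z ^+ i2; set z3 := z ^+ i3; set t := z ^+ j.
set a1 : 'Z_q := i1%:R; set a2 : 'Z_q := i2%:R; set a3 : 'Z_q := i3%:R.
set b : 'Z_q := j%:R => s e.
have full r : r \in [:: a1; - a1; a2; - a2; a3; - a3; b; - b].
  apply: contraT; rewrite !inE !negb_or ![r == _]eq_sym => /and5P[n1 n2 n3 n4 /and4P[n5 n6 n7 n8]].
  case/eqP: f_neq0; apply: (@mulfI _ (w ^+ r)).
    rewrite expf_neq0 //; apply: contra_eq_neq wq => ->.
    by rewrite expr0n gtn_eqF ?(ltnW q1) // eq_sym oner_neq0.
  by rewrite mulr0 -e !class_part_out // oppr0 !addr0.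
have a10 : a1 != 0.
  apply/eqP => a10; apply: (@no_cover_class0 q a2 a3 b) => [|| r].
  - exact: ltnW.
  - by rewrite -s a10 add0r.
  - by rewrite -a10; exact: full.
have a20 : a2 != 0.
  apply/eqP => a20; apply: (@no_cover_class0 q a1 a3 b) => [|| r].
  - exact: ltnW.
  - by rewrite -s a20 addr0.
  - rewrite -a20; have := full r; rewrite !inE.
    by do 7!(case/orP; first by move=> ->; rewrite ?orbT); move=> ->; rewrite ?orbT.
have a30 : a3 != 0.
  apply/eqP => a30; apply: (@no_cover_class0 q a1 a2 b) => [|| r].
  - exact: ltnW.
  - by rewrite -s a30 addr0.
  - rewrite -a30; have := full r; rewrite !inE.
    by do 7!(case/orP; first by move=> ->; rewrite ?orbT); move=> ->; rewrite ?orbT.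
have b0 : b = 0.
  apply/eqP; have := full 0; rewrite !inE ![0 == _]eq_sym !oppr_eq0.
  by rewrite (negPf a10) (negPf a20) (negPf a30) orbb.
pose l := [:: 0; a1; - a1; a2; - a2; a3; - a3].
have full7 r : r \in l.
  have := full r; rewrite !inE b0 oppr0.
  by do 7!(case/orP; first by move=> ->; rewrite ?orbT); move=> ->; rewrite ?orbT.
have q7 : q = 7%N by apply/eqP; rewrite eqn_leq q6 andbT; exact: sub_full_card full7.
have l_uniq : uniq l.
  apply: (leq_size_uniq (enum_uniq 'Z_q)) => [r _|]; first exact: full7.
  have -> : size (enum 'Z_q) = q by rewrite -cardE card_ord Zp_cast.
  exact: q6.
move: l_uniq; rewrite /= !inE !negb_or.
move=> /andP[_ /andP[/and5P[n11 n12 Nn12 n13 Nn13] /andP[_ /andP[/and3P[n22 n23 Nn23]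
  /andP[_ /andP[n33 _]]]]]].
have part0 (a : 'Z_q) (y : K) : a != 0 -> class_part a y 0 = 0.
  by move=> a0; rewrite class_part_out ?oppr_eq0.
have f2 : (t + t^-1) ^+ 2 = f ^+ 2.
  by have := e 0; rewrite b0 class_part00 !part0 // !add0r expr0 mul1r => <-; rewrite sqrrN.
have w14 : w ^+ 14 = 1 by rewrite (exprM w 7 2) -q7 wq expr1n.
have lone y1 y2 y3 (c1 c2 c3 : 'Z_q) : y1 != 0 -> c1 != 0 ->
    c1 != - c1 -> c1 != c2 -> c1 != - c2 -> c1 != c3 -> c1 != - c3 ->
    (forall r : 'Z_q, class_part c1 y1 r + class_part c2 y2 r + class_part c3 y3 r
        - class_part b t r = w ^+ r * f) -> y1 ^+ 14 = 1 /\ f ^+ 2 = 1.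
  move=> y10 c10 d11 d12 Nd12 d13 Nd13 ye.
  have dN (c : 'Z_q) : (- c == - c1) = (c1 == c) by rewrite eqr_opp eq_sym.
  have dN' (c : 'Z_q) : (c == - c1) = (c1 == - c) by rewrite -eqr_oppLR eq_sym.
  have e1 : y1 = w ^+ c1 * f.
    rewrite -ye b0 class_part_id 1?eq_sym // class_part0 // subr0.
    by rewrite !class_part_out ?addr0 // eq_sym.
  have e2 : y1^-1 = w ^+ (- c1)%R * f.
    rewrite -ye b0 [class_part 0 _ _]class_part0 ?oppr_eq0 // subr0 class_partN.
    rewrite class_part_id 1?eq_sym //.
    by rewrite !class_part_out ?addr0 // ?dN' ?dN ?opprK.
  have f21 : f ^+ 2 = 1.
    have : (q %| c1 + (- c1)%R)%N by rewrite -Zp_nat_eq0 // natrD !natr_Zp subrr.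
    move=> /dvdnP[k wE]; have <- : y1 * y1^-1 = 1 by rewrite divff.
    by rewrite e2 e1 mulrACA -exprD wE mulnC exprM wq expr1n mul1r.
  split=> //; rewrite e1 exprMn exprAC w14 expr1n mul1r.
  by rewrite (exprM f 2 7) f21 expr1n.
have [z10 z20 z30] : [/\ z1 != 0, z2 != 0 & z3 != 0] by case: rel => _ /prod3_neq0.
have t0 : t != 0 by case: rel.
have dN (c d : 'Z_q) : (d == - c) = (c == - d) by rewrite -eqr_oppLR eq_sym.
have [z1_14 f1] := lone z1 z2 z3 a1 a2 a3 z10 a10 n11 n12 Nn12 n13 Nn13 e.
have [z2_14 _] : z2 ^+ 14 = 1 /\ f ^+ 2 = 1.
  apply: (lone z2 z1 z3 a2 a1 a3) => // [||r]; first by rewrite eq_sym.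
    by rewrite dN.
  by rewrite -e [class_part a2 _ _ + _]addrC.
have [z3_14 _] : z3 ^+ 14 = 1 /\ f ^+ 2 = 1.
  apply: (lone z3 z1 z2 a3 a1 a2) => // [||||r]; [by rewrite eq_sym|by rewrite dN| | |].
  - by rewrite eq_sym.
  - by rewrite dN.
  - by rewrite -e; congr (_ - _); rewrite -addrA addrC.
have t6 : t ^+ 6 = 1.
  have := f2; rewrite f1 => tE; apply/eqP; rewrite -subr_eq0; apply/eqP.
  transitivity (t ^+ 2 * (t ^+ 2 - 1) * ((t + t^-1) ^+ 2 - 1)); first by field.
  by rewrite tE subrr mulr0.
split.
- by rewrite (exprM z1 14 3) z1_14 expr1n.
- by rewrite (exprM z2 14 3) z2_14 expr1n.
- by rewrite (exprM z3 14 3) z3_14 expr1n.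
- by rewrite (exprM t 6 7) t6 expr1n.
Qed.

Lemma class_part_Z2 (i : nat) z :
  class_part (i%:R : 'Z_2) z 1 = (z + z^-1) *+ odd i.
Proof.
have -> : i%:R = (odd i)%:R :> 'Z_2.
  by rewrite -[i in LHS]odd_double_half natrD -mul2n natrM char_Zp // mul0r addr0.
by rewrite /class_part; case: (odd i) => /=; rewrite ?mulr1n ?addr0.
Qed.

Lemma inv_sum_eq0 t : t != 0 -> t + t^-1 = 0 -> t ^+ 4 = 1.
Proof.
move=> t0 e; apply/eqP; rewrite -subr_eq0; apply/eqP.
transitivity (t * (t + t^-1) * (t ^+ 2 - 1)); first by field.
by rewrite e mulr0 mul0r.
Qed.

Lemma dvdn4_expr N z i : (16 %| N)%N -> N.-primitive_root z ->
  (z ^+ i) ^+ 4 = 1 -> (4 %| i)%N.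
Proof.
move=> N16 prim_z /eqP; rewrite -exprM -(prim_order_dvd prim_z) => /(dvdn_trans N16).
by rewrite (_ : 16%N = (4 * 4)%N) // dvdn_pmul2r.
Qed.

(** The classes mod 2 leave the possibility z1^2 = -1 open. It is excluded by the
classes mod 4: there z1 has class 0 because 16 divides N, and z2, z3 have
classes 1 and - 1, so [degenerate_class0] applies. *)
Lemma reduce_16_odd23 N z i1 i2 i3 j : (16 %| N)%N -> N.-primitive_root z ->
  cos_relation (z ^+ i1) (z ^+ i2) (z ^+ i3) (z ^+ j) ->
  (forall r : 'Z_2, class_part i1%:R (z ^+ i1) r + class_part i2%:R (z ^+ i2) r
     + class_part i3%:R (z ^+ i3) r = class_part j%:R (z ^+ j) r) ->
  odd i2 -> odd i3 -> ~~ odd i1 ->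
  degenerate (z ^+ i1) (z ^+ i2) (z ^+ i3) (z ^+ j).
Proof.
move=> N16 prim_z rel e o2 o3 e1; have [t0 p e0] := rel.
have := e 1; rewrite !class_part_Z2 o2 o3 (negPf e1) mulr0n add0r !mulr1n.
case: (boolP (odd j)) => _; last by rewrite mulr0n; exact: degenerate_pair.
rewrite mulr1n => e23.
have z10 : z ^+ i1 + (z ^+ i1)^-1 = 0.
  by apply: (addIr (z ^+ j + (z ^+ j)^-1)); rewrite add0r -{1}e23 addrA e0.
have d4i1 : (4 %| i1)%N.
  apply: dvdn4_expr N16 prim_z (inv_sum_eq0 _ z10).
  by case: (prod3_neq0 p).
have [M NE] : exists M, N = (4 * M)%N.
  by exists (N %/ 4)%N; rewrite mulnC divnK // (dvdn_trans _ N16).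
have M4 : (4 %| M)%N by move: N16; rewrite NE (_ : 16%N = (4 * 4)%N) // dvdn_pmul2l.
rewrite NE in prim_z.
have cop k : (k < 4)%N -> coprime (1 + M * k) (4 * M).
  rewrite coprimeMr coprime_succ_mul andbT (_ : 4%N = (2 ^ 2)%N) // coprimeXr //.
  by rewrite coprimen2 oddD oddM (_ : odd M = false) //; lia.
have [|s [w [f [_ f0 ef]]]] := class_equation (isT : 1 < 4)%N prim_z _ rel.
  by move=> k1 k2 /cop ->.
have crel := class_relation_of (isT : 1 < 4)%N (f0 cop) s ef.
have i10 : i1%:R = 0 :> 'Z_4 by apply/eqP; rewrite Zp_nat_eq0.
rewrite i10 in crel; apply: degenerate_class0 rel crel.
rewrite -subr_eq0 -opprD oppr_eq0 -natrD Zp_nat_eq0 //.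
by move: o2; lia.
Qed.

Lemma reduce_16 M z i1 i2 i3 j : (16 %| 2 * M)%N -> (2 * M).-primitive_root z ->
  cos_relation (z ^+ i1) (z ^+ i2) (z ^+ i3) (z ^+ j) ->
  degenerate (z ^+ i1) (z ^+ i2) (z ^+ i3) (z ^+ j) \/
  common_torsion M (z ^+ i1) (z ^+ i2) (z ^+ i3) (z ^+ j).
Proof.
move=> M16 prim_z rel; have [t0 p e0] := rel.
have M2 : (2 %| M)%N by move: M16; lia.
have cop := coprime_shift_all (isT : prime 2) M2.
have [s [w [f [_ f0 ef]]]] := class_equation (isT : 1 < 2)%N prim_z
  (fun k1 k2 => @coprime_shift_uniq 2 M k1 k2 isT) rel.
have [_ e] := class_relation_of (isT : 1 < 2)%N (f0 cop) s ef.
have : ~~ odd (i1 + i2 + i3).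
  by move/eqP: s; rewrite -!natrD Zp_nat_eq0 // dvdn2.
rewrite !oddD.
case: (boolP (odd i1)) (boolP (odd i2)) (boolP (odd i3))
  => [par1|par1] [par2|par2] [par3|par3] // _; last 1 first.
- case: (boolP (odd j)) => oj.
    have := e 1; rewrite !class_part_Z2 (negPf par1) (negPf par2) (negPf par3) oj.
    rewrite !mulr0n mulr1n !addr0.
    move/esym/(inv_sum_eq0 t0)/(dvdn4_expr M16 prim_z) => j4.
    by move: oj; rewrite -[j](divnK j4) oddM andbF.
  by right; apply: reduce_exponents prim_z _ => //; rewrite !dvdn2.
- left; apply/degenerate13; apply: (reduce_16_odd23 M16 prim_z (cos_relation13 rel)) => // r.
  by rewrite -e [LHS]addrC addrA addrAC.
- left; apply/degenerate12; apply: (reduce_16_odd23 M16 prim_z (cos_relation12 rel)) => // r.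
  by rewrite -e [class_part i2%:R _ _ + _]addrC.
- by left; apply: (reduce_16_odd23 M16 prim_z rel).
Qed.

(** Order 42 accounts for the exceptional solution at q = 7, z_i = zeta^(1, 2, 4)
with zeta of order 7. *)
Theorem cos_relation_torsion N z z1 z2 z3 t : N.-primitive_root z ->
  common_torsion N z1 z2 z3 t -> cos_relation z1 z2 z3 t ->
  [\/ degenerate z1 z2 z3 t, common_torsion 120 z1 z2 z3 t | common_torsion 42 z1 z2 z3 t].
Proof.
elim/ltn_ind: N z => N IH z prim_z tor rel; have N0 := prim_order_gt0 prim_z.
have [/dvdnP[k kE]|N120] := boolP (N %| 120)%N.
  case: tor => t1 t2 t3 t4; apply: Or32.
  by split; rewrite kE mulnC exprM ?t1 ?t2 ?t3 ?t4 expr1n.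
have exps y : y ^+ N = 1 -> exists i : nat, y = z ^+ i.
  by move=> /(prim_rootP prim_z)[i ->]; exists i.
have reduce q M : (1 < q)%N -> N = (q * M)%N -> common_torsion M z1 z2 z3 t ->
    [\/ degenerate z1 z2 z3 t, common_torsion 120 z1 z2 z3 t | common_torsion 42 z1 z2 z3 t].
  move=> q1 NE torM; have M0 : (0 < M)%N by move: N0; rewrite NE muln_gt0 => /andP[].
  apply: (IH M _ (z ^+ q)) torM rel; first by rewrite NE ltn_Pmull.
  have := dvdn_prim_root prim_z (_ : M %| N)%N; rewrite NE mulnK //; apply.
  exact: dvdn_mull.
case: tor => /exps[i1 z1E] /exps[i2 z2E] /exps[i3 z3E] /exps[j tE].
rewrite z1E z2E z3E tE in rel reduce *.
have [N16|[q q_pr /andP[q_odd /dvdnP[M NE]]]|[q q_pr /andP[q6 /dvdnP[M NE]]]] :=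
  dvdn120P N0 N120.
- have [M NE] : exists M, N = (2 * M)%N.
    by exists (N %/ 2)%N; rewrite mulnC divnK // (dvdn_trans _ N16).
  have := reduce _ _ _ NE; rewrite NE in N16 prim_z => red.
  by have [D|/red] := reduce_16 N16 prim_z rel; [apply: Or31|apply].
- have := reduce q (q * M)%N (prime_gt1 q_pr); rewrite NE -mulnn mulnC -mulnA => /(_ erefl) red.
  rewrite NE -mulnn mulnC -mulnA in prim_z.
  have [|D|/red //] := reduce_odd_square q_pr q_odd _ prim_z rel; first exact: dvdn_mulr.
  exact: Or31.
- have := reduce q M (prime_gt1 q_pr); rewrite NE mulnC => /(_ erefl) red.
  rewrite NE mulnC in prim_z.
  by have [D|/red|D] := reduce_large_prime q_pr q6 prim_z rel; [exact: Or31| |exact: Or33].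
Qed.
End Reduction.

(** * The finite verification *)

(** These computable conditions make P a divisor of Phi_N(2), see
[Cyclotomic_modulus]. *)
Definition cyclotomic_modulus (N : nat) (P : Z) : bool :=
  [&& (0 <? P)%Z, ((2 ^+ N - 1)%R mod P =? 0)%Z &
  all (fun d => (Z.gcd P (2 ^+ d - 1)%R =? 1)%Z) [seq d <- divisors N | d != N]].

(** P divides 2^N - 1, the product of the Phi_d(2) over d dividing N, and is
coprime to the factors with d < N, since these divide 2^d - 1. *)
Lemma Cyclotomic_modulus N P : (0 < N)%N -> cyclotomic_modulus N P ->
  (P | (map_poly intr 'Phi_N).[2%R])%Z.
Proof.
move=> N0 /and3P[/Z.ltb_lt P0 /Z.eqb_spec PN /allP Pd].
pose ev (p : {poly int}) : Z := (map_poly intr p).[2%R].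
have evM p q : ev (p * q) = ev p * ev q by rewrite /ev rmorphM hornerM.
have evXn d : ev ('X^d - 1) = 2 ^+ d - 1.
  by rewrite /ev rmorphB /= map_polyXn rmorph1 !hornerE.
have dvd_ev d : (0 < d)%N -> (ev 'Phi_d | (2 ^+ d - 1)%R)%Z.
  move=> d0; rewrite -evXn -prod_Cyclotomic //.
  rewrite (big_rem d) -?dvdn_divisors ?dvdnn //= evM; exact: Z.divide_factor_l.
pose rest := \prod_(d <- divisors N | d != N) 'Phi_d.
have evN : ev rest * ev 'Phi_N = 2 ^+ N - 1.
  rewrite -evXn -prod_Cyclotomic // (bigD1_seq N) ?divisors_uniq -?dvdn_divisors //=.
  by rewrite evM mulrC.
have : (P | (ev rest * ev 'Phi_N)%R)%Z.
  by rewrite evN; apply/Z.mod_divide => //; lia.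
move/Z.gauss; apply; rewrite /rest.
have {Pd} Pd d : d \in [seq d <- divisors N | d != N] ->
    (0 < d)%N /\ rel_prime P (2 ^+ d - 1)%R.
  move=> dN; split; last by apply/Zgcd_1_rel_prime/Z.eqb_spec; exact: Pd.
  by move: dN; rewrite mem_filter -dvdn_divisors // => /andP[_ /dvdn_gt0]; apply.
rewrite -big_filter; elim: [seq d <- divisors N | d != N] Pd => [|d s IHs] Pd.
  by rewrite big_nil /ev rmorph1 hornerC; apply: Z.gcd_1_r.
rewrite big_cons evM; apply/Zgcd_1_rel_prime; apply: rel_prime_mult.
  have [d0 Pd1] := Pd d (mem_head d s).
  by apply/rel_prime_sym; apply: rel_prime_div (dvd_ev d d0); apply: rel_prime_sym.
by apply/Zgcd_1_rel_prime/IHs => e es; apply: Pd; rewrite inE es orbT.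
Qed.

Lemma horner_modulus (K : numFieldType) N P (z : K) (p : {poly int}) :
  cyclotomic_modulus N P -> N.-primitive_root z -> root (map_poly intr p) z ->
  (P | (map_poly intr p).[2%R])%Z.
Proof.
move=> NP prim_z /(Cyclotomic_factor prim_z)[q ->]; rewrite rmorphM hornerM.
apply: Z.divide_mul_r; apply: Cyclotomic_modulus NP; exact: prim_order_gt0 prim_z.
Qed.

Definition sporadic_pairs : seq (nat * nat) :=
  [:: (3, 4); (3, 5); (4, 3); (5, 4); (8, 6)]%N.

Definition allowed_pair (n m : nat) : bool := (n == m) || ((n, m) \in sporadic_pairs).

(** The residue of 2 cos(2 pi i/N), the root of unity being sent to 2. The
exponent 2 N - i stands for - i and is defined for the sum of two indices. *)
Definition cos_mod N P i : Z := ((2 ^+ i + 2 ^+ (2 * N - i))%R mod P)%Z.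

(** Reduction of a sum of three residues; much cheaper than a division. *)
Definition sub_mod (P x : Z) : Z :=
  if Z.ltb x P then x else let y := Z.sub x P in if Z.ltb y P then y else Z.sub y P.

(** The residue of |1 + z1 + z2 + z3|^2 - 2 for z1 and z2 of exponents i and j,
before reduction. *)
Definition trace_norm N i j : Z :=
  (1 + 2 ^+ i + 2 ^+ j + 2 ^+ (2 * N - (i + j)))
  * (1 + 2 ^+ (2 * N - i) + 2 ^+ (2 * N - j) + 2 ^+ (i + j)) - 2.

(** The conditionals are not written as implications because [vm_compute] would
evaluate both sides of an implication. *)
Definition braid_pair_check N P : bool :=
  let cosines := mkseq (cos_mod N P) (2 * N) in
  let targets := [seq (n, cos_mod N P (N %/ n)) | n <- divisors N & (2 < n)%N] in
  all (fun i => all (fun j =>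
    let c := sub_mod P (nth Z0 cosines i + nth Z0 cosines j + nth Z0 cosines (i + j)%N)%Z in
    all (fun n => if (n.2 =? c)%Z then
        let d := (trace_norm N i j mod P)%Z in
        all (fun m => if (m.2 =? d)%Z then allowed_pair n.1 m.1 else true) targets
      else true) targets)
    (iota 0 N)) (iota 0 N).

Lemma sub_modE (P x : Z) : Z.le 0 x -> Z.lt x (Z.mul 3 P) ->
  sub_mod P x = Z.modulo x P.
Proof.
move=> x_ge0 x_lt; rewrite /sub_mod; case: Z.ltb_spec => xP.
  by rewrite Z.mod_small //; lia.
case: Z.ltb_spec => xP2.
  by apply: (Zmod_unique x P 1); lia.
by apply: (Zmod_unique x P 2); lia.
Qed.

Lemma sub_mod_add3 (P x y z : Z) : Z.lt 0 P ->
  sub_mod P (Z.add (Z.add (Z.modulo x P) (Z.modulo y P)) (Z.modulo z P)) =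
  Z.modulo (x + y + z)%R P.
Proof.
move=> P0; have bd u := Z.mod_pos_bound u P P0.
have := bd x; have := bd y; have := bd z => bz by_ bx.
rewrite sub_modE; try lia.
by rewrite Zplus_mod_idemp_r -Zplus_mod_idemp_l -Zplus_mod Zplus_mod_idemp_l.
Qed.

Lemma eq_mod_divide (P x y : Z) : Z.divide P (x - y)%R -> Z.modulo x P = Z.modulo y P.
Proof.
case=> k E; have -> : x = Z.add y (Z.mul k P) by rewrite -E; lia.
exact: Z_mod_plus_full.
Qed.

Definition cos_poly N i j k : {poly int} :=
  'X^i + 'X^(2 * N - i) + ('X^j + 'X^(2 * N - j))
  + ('X^(i + j) + 'X^(2 * N - (i + j))) - ('X^k + 'X^(2 * N - k)).

Definition norm_poly N i j k : {poly int} :=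
  (1 + 'X^i + 'X^j + 'X^(2 * N - (i + j)))
  * (1 + 'X^(2 * N - i) + 'X^(2 * N - j) + 'X^(i + j)) - 2
  - ('X^k + 'X^(2 * N - k)).

Lemma horner_cos_poly (R : comNzRingType) N i j k (x : R) :
  (map_poly intr (cos_poly N i j k)).[x] =
  x ^+ i + x ^+ (2 * N - i) + (x ^+ j + x ^+ (2 * N - j))
  + (x ^+ (i + j) + x ^+ (2 * N - (i + j))) - (x ^+ k + x ^+ (2 * N - k)).
Proof. by rewrite !(rmorphB, rmorphD) /= !map_polyXn !hornerE. Qed.

Lemma horner_norm_poly (R : comNzRingType) N i j k (x : R) :
  (map_poly intr (norm_poly N i j k)).[x] =
  (1 + x ^+ i + x ^+ j + x ^+ (2 * N - (i + j)))
  * (1 + x ^+ (2 * N - i) + x ^+ (2 * N - j) + x ^+ (i + j)) - 2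
  - (x ^+ k + x ^+ (2 * N - k)).
Proof.
by rewrite !(rmorphB, rmorphD, rmorphM, rmorph1, rmorph_nat) /= !map_polyXn !hornerE.
Qed.

Lemma braid_pair_check_sound (K : numFieldType) N P (z : K) i j n m :
  cyclotomic_modulus N P -> braid_pair_check N P -> N.-primitive_root z ->
  (i < N)%N -> (j < N)%N -> (n %| N)%N -> (m %| N)%N -> (2 < n)%N -> (2 < m)%N ->
  let z1 := z ^+ i in let z2 := z ^+ j in let z3 := (z1 * z2)^-1 in
  let t := z ^+ (N %/ n) in let w := z ^+ (N %/ m) in
  z1 + z1^-1 + (z2 + z2^-1) + (z3 + z3^-1) = t + t^-1 ->
  (1 + z1 + z2 + z3) * (1 + z1^-1 + z2^-1 + z3^-1) = 2 + w + w^-1 ->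
  allowed_pair n m.
Proof.
move=> NP check prim_z iN jN nN mN n2 m2 z1 z2 z3 t w cos_eq norm_eq.
have N0 := prim_order_gt0 prim_z.
have inv_z k : (k <= 2 * N)%N -> z ^+ (2 * N - k) = (z ^+ k)^-1.
  move=> kN; have zu : z ^+ k != 0 by rewrite expf_neq0 // (prim_root_eq0 prim_z) -lt0n.
  apply: (mulIf zu); rewrite mulVf // -exprD subnK // mulnC exprM.
  by rewrite (prim_expr_order prim_z) expr1n.
have quo_le k : (N %/ k <= 2 * N)%N by apply: leq_trans (leq_div _ _) _; lia.
have ij_le : (i + j <= 2 * N)%N by lia.
have [iN2 jN2] : (i < 2 * N)%N /\ (j < 2 * N)%N by lia.
have [iN2' jN2'] := (ltnW iN2, ltnW jN2).
have rel1 := @horner_modulus K N P z (cos_poly N i j (N %/ n)) NP prim_z.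
have rel2 := @horner_modulus K N P z (norm_poly N i j (N %/ m)) NP prim_z.
rewrite !rootE !horner_cos_poly !inv_z // in rel1.
rewrite !rootE !horner_norm_poly !inv_z // in rel2.
have z3E : (z ^+ (i + j))^-1 = z3 by rewrite exprD.
rewrite z3E -[z ^+ (i + j)]invrK z3E [z3^-1 + _]addrC cos_eq subrr eqxx in rel1.
have e2 : 2 + w + w^-1 - 2 - (w + w^-1) = 0 by ring.
rewrite z3E -[z ^+ (i + j)]invrK z3E norm_eq e2 eqxx in rel2.
have P0 : Z.lt 0 P by case/and3P: NP => /Z.ltb_lt.
have /eq_mod_divide c1 := rel1 isT.
have /eq_mod_divide c2 := rel2 isT.
have target k : (k %| N)%N -> (2 < k)%N ->
    (k, cos_mod N P (N %/ k)) \in [seq (n, cos_mod N P (N %/ n)) | n <- divisors N & (2 < n)%N].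
  by move=> kN k2; apply: map_f; rewrite mem_filter k2 -dvdn_divisors.
move/allP: check => /(_ i); rewrite mem_iota iN => /(_ isT)/allP/(_ j).
rewrite mem_iota jN => /(_ isT)/allP/(_ _ (target n nN n2)) /=.
rewrite !nth_mkseq //; last by lia.
rewrite sub_mod_add3 // c1 /cos_mod Z.eqb_refl => /allP/(_ _ (target m mN m2)) /=.
by rewrite /trace_norm c2 Z.eqb_refl.
Qed.

(** * Classification of the pairs *)

(** If a cosine lies in the N-th cyclotomic field, so does the root of unity.
For a prime q dividing L/N, the terms of l have class 0 mod q; if z^j has a
nonzero class, it is alone there, unless q = 2, where z^j + z^-j = 0. The
divisibility of N by 12 covers q = 2 and q = 3, for which the class 2 j need
not be empty. *)
Lemma cos_in_cyclotomic (K : numFieldType) N L (z : K) j l :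
  (12 %| N)%N -> (N %| L)%N -> L.-primitive_root z ->
  expsum (z ^+ (L %/ N)) l = z ^+ j + (z ^+ j)^-1 -> (z ^+ j) ^+ N = 1.
Proof.
move=> N12; elim/ltn_ind: L z j => L IH z j NL prim_z e.
have L0 := prim_order_gt0 prim_z; have N0 := dvdn_gt0 L0 NL.
have zu i : z ^+ i != 0 by rewrite expf_neq0 // (prim_root_eq0 prim_z) -lt0n.
have [LN1|LN1] := leqP (L %/ N) 1.
  rewrite exprAC; have -> : N = L; last by rewrite (prim_expr_order prim_z) expr1n.
  apply/eqP; rewrite eqn_dvd NL /= -{1}(divnK NL).
  have : (0 < L %/ N)%N by rewrite divn_gt0 // dvdn_leq.
  by case: (L %/ N)%N LN1 => [|[|k]] // _ _; rewrite mul1n.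
have [q q_pr qLN] := pdivP LN1; have q1 := prime_gt1 q_pr.
have qL : (q %| L)%N by apply: dvdn_trans qLN (dvdn_div NL).
have [M LE] : exists M, L = (q * M)%N by exists (L %/ q)%N; rewrite mulnC divnK.
have NM : (N %| M)%N.
  move: qLN; rewrite dvdn_divRL // LE dvdn_pmul2l //; exact: ltnW.
have [qj|qj] := boolP (q %| j)%N.
  have [i jE] : exists i, j = (q * i)%N by exists (j %/ q)%N; rewrite mulnC divnK.
  have M0 : (0 < M)%N by move: L0; rewrite LE muln_gt0 => /andP[].
  rewrite jE exprM; apply: (IH M) => //; first by rewrite LE ltn_Pmull.
    have := dvdn_prim_root prim_z (_ : M %| L)%N; rewrite LE mulnK //; apply.
    exact: dvdn_mull.
  by rewrite -!exprM -jE -e LE muln_divA.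
pose l' : seq (int * nat) := [seq (x.1, (L %/ N * x.2)%N) | x <- l] ++
  [:: (-1, j); (-1, (L.-1 * j)%N)].
have inv_z : z ^+ (L.-1 * j) = (z ^+ j)^-1.
  apply: (mulIf (zu j)); rewrite mulVf // -exprD addnC -mulSn prednK // exprM.
  by rewrite (prim_expr_order prim_z) ?expr1n.
have l'0 : expsum z l' = 0.
  rewrite /expsum big_cat big_map !big_cons big_nil /= inv_z rmorphN1 !mulN1r addr0.
  rewrite -opprD -e /expsum; apply/eqP; rewrite subr_eq0; apply/eqP.
  by apply: eq_bigr => x _; rewrite exprM.
rewrite LE in prim_z.
have [w [f [wq f0 fE]]] := expsum_class (ltnW q1) prim_z
  (fun k1 k2 => @coprime_shift_uniq q M k1 k2 q_pr) l'0.
have oppE r : (L.-1 * j == r %[mod q]) = (q %| r + j)%N.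
  rewrite -(eqn_modDr j) addnC -mulSn prednK // LE -mulnA modnMr.
  by rewrite eq_sym.
have classE r : ~~ (q %| r)%N -> w ^+ r * f =
    expsum z [seq x <- [:: (-1, j); (-1, (L.-1 * j)%N)] | x.2 == r %[mod q]].
  move=> qr; rewrite -fE filter_cat; set s := seq.filter _ (map _ _).
  suff -> : s = [::] by [].
  apply/eqP; rewrite -size_eq0 size_filter -leqn0 leqNgt -has_count -all_predC.
  apply/allP => x /mapP[y _ ->] /=; apply: contra qr => /eqP.
  by rewrite /dvdn => <-; apply: dvdn_mulr.
have f_eq0 : f = 0.
  have [qM|qM] := boolP (q %| M)%N; first exact: f0 (coprime_shift_all q_pr qM).
  have q_gt3 : (3 < q)%N.
    have M12 := dvdn_trans N12 NM.
    case: q {q1 q_pr qLN qL LE qj prim_z wq f0 fE oppE classE} qM q1 q_pr => [|[|[|[|q]]]] //.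
      by case/negP; apply: dvdn_trans M12.
    by case/negP; apply: dvdn_trans M12.
  have := classE (2 * j)%N; rewrite Euclid_dvdM // negb_or qj andbT gtnNdvd ?(ltnW q_gt3) //.
  rewrite /= oppE (_ : 2 * j + j = 3 * j)%N; last by lia.
  rewrite Euclid_dvdM // (negPf qj) orbF gtnNdvd //.
  have -> : (j == 2 * j %[mod q]) = false.
    by rewrite mul2n -addnn -{1}[j]add0n eqn_modDr mod0n eq_sym; exact: negPf qj.
  rewrite /expsum big_nil => /(_ isT)/eqP; rewrite mulf_eq0 expf_eq0.
  move=> /orP[/andP[_ /eqP w0]|/eqP//].
  by move: wq; rewrite w0 expr0n gtn_eqF ?(ltnW q1) // => /eqP; rewrite eq_sym oner_eq0.
have := classE j qj; rewrite f_eq0 mulr0 /= eqxx oppE addnn -mul2n Euclid_dvdM // (negPf qj) orbF.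
have [q2|q2] := boolP (q %| 2)%N; last first.
  rewrite /expsum big_cons big_nil rmorphN1 mulN1r addr0 => /esym/eqP.
  by rewrite oppr_eq0 (negPf (zu j)).
rewrite /expsum !big_cons big_nil /= inv_z rmorphN1 !mulN1r addr0 -opprD => /esym/eqP.
rewrite oppr_eq0 => /eqP/(inv_sum_eq0 (zu j)) zj4.
have /dvdnP[k ->] : (4 %| N)%N by apply: dvdn_trans N12.
by rewrite mulnC exprM zj4 expr1n.
Qed.

Lemma expsumM (R : comNzRingType) (z : R) (l1 l2 : seq (int * nat)) :
  expsum z [seq (x.1 * y.1, (x.2 + y.2)%N) | x <- l1, y <- l2] =
  expsum z l1 * expsum z l2.
Proof.
rewrite /expsum big_allpairs_dep /= big_distrlr /=; apply: eq_bigr => x _.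
by apply: eq_bigr => y _; rewrite rmorphM exprD mulrACA.
Qed.

(** The moduli chosen here and below are Phi_120(2) and Phi_84(2). *)
Lemma cyclotomic_modulus_120 : cyclotomic_modulus 120 4562284561.
Proof. by vm_compute. Qed.

Lemma cyclotomic_modulus_84 : cyclotomic_modulus 84 20647621.
Proof. by vm_compute. Qed.

Lemma braid_pair_check_120 : braid_pair_check 120 4562284561.
Proof. by vm_compute. Qed.

Lemma braid_pair_check_84 : braid_pair_check 84 20647621.
Proof. by vm_compute. Qed.

Section BraidPairs.
(** Here e n plays the part of exp(2 pi i/n). *)
Variables (K : numFieldType) (e : nat -> K).
Hypothesis e_prim : forall n, (0 < n)%N -> n.-primitive_root (e n).
Hypothesis e_exp : forall a b, (0 < a)%N -> (0 < b)%N -> e (a * b) ^+ a = e b.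

Definition trace_relation (z1 z2 z3 w : K) : Prop :=
  (1 + z1 + z2 + z3) * (1 + z1^-1 + z2^-1 + z3^-1) = 2 + w + w^-1.

Lemma inv_sum_inj (t w : K) : t != 0 -> w != 0 -> t + t^-1 = w + w^-1 ->
  t = w \/ t = w^-1.
Proof.
move=> t0 w0 tw; have /eqP : (t - w) * (t - w^-1) = 0.
  have -> : (t - w) * (t - w^-1) = t * (t + t^-1 - (w + w^-1)) by field; rewrite t0 w0.
  by rewrite tw subrr mulr0.
by rewrite mulf_eq0 !subr_eq0 => /orP[/eqP|/eqP]; [left|right].
Qed.

Lemma e_neq0 n : (0 < n)%N -> e n != 0.
Proof. by move=> n0; rewrite (prim_root_eq0 (e_prim n0)) -lt0n. Qed.

Lemma e_dvd n k : (0 < n)%N -> e n ^+ k = 1 -> (n %| k)%N.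
Proof. by move=> n0 /eqP; rewrite -(prim_order_dvd (e_prim n0)). Qed.

Lemma e_cos_inj n m : (0 < n)%N -> (0 < m)%N ->
  e n + (e n)^-1 = e m + (e m)^-1 -> n = m.
Proof.
move=> n0 m0 /(inv_sum_inj (e_neq0 n0) (e_neq0 m0)) nm; apply/eqP.
rewrite eqn_dvd; apply/andP; split; apply: e_dvd => //.
  by case: nm => ->; rewrite ?exprVn (prim_expr_order (e_prim m0)) ?invr1.
case: nm => [<-|nm]; first by rewrite (prim_expr_order (e_prim n0)).
by rewrite -[e m]invrK -nm exprVn (prim_expr_order (e_prim n0)) invr1.
Qed.

(** With z2 = - z1 both equations involve z3 only, and they read
2 cos(2 pi/n) = z3 + z3^-1 = 2 cos(2 pi/m). *)
Lemma braid_pair_cancel n m z1 z2 z3 : (0 < n)%N -> (0 < m)%N ->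
  cos_relation z1 z2 z3 (e n) -> trace_relation z1 z2 z3 (e m) ->
  z1 + z2 = 0 -> n = m.
Proof.
move=> n0 m0 [_ p cos_eq] tr_eq /eqP; rewrite addrC addr_eq0 => /eqP z2E.
have [z10 _ z30] := prod3_neq0 p.
apply: e_cos_inj => //; rewrite -cos_eq; apply: (addrI 2); rewrite [RHS]addrA -tr_eq z2E.
by field; rewrite z10 z30.
Qed.

(** When z1 + z2 + z3 = 0 the equations become cos(2 pi/n) = 0 and
1 = 2 + 2 cos(2 pi/m), so n = 4 and m = 3. *)
Lemma braid_pair_degenerate n m z1 z2 z3 : (2 < n)%N -> (2 < m)%N ->
  cos_relation z1 z2 z3 (e n) -> trace_relation z1 z2 z3 (e m) ->
  degenerate z1 z2 z3 (e n) -> allowed_pair n m.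
Proof.
move=> n2 m2 rel tr_eq; have n0 := ltnW (ltnW n2); have m0 := ltnW (ltnW m2).
have [t0 p cos_eq] := rel.
case=> [tN1|/eqP|[s0 s0']].
- have /dvdn_leq : (n %| 2)%N by apply: e_dvd => //; rewrite tN1 sqrrN expr1n.
  by move=> /(_ isT); rewrite leqNgt n2.
- rewrite !mulf_eq0 -orbA => /or3P pairs; apply/orP; left; apply/eqP.
  case: pairs => /eqP z0.
  + exact: braid_pair_cancel rel tr_eq z0.
  + apply: (braid_pair_cancel n0 m0 (cos_relation12 (cos_relation13 (cos_relation12 rel))) _ z0).
    by rewrite /trace_relation -tr_eq; ring.
  + apply: (braid_pair_cancel n0 m0 (cos_relation13 rel) _ _).
      by rewrite /trace_relation -tr_eq; ring.
    by rewrite addrC.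
have t4 : e n ^+ 4 = 1.
  apply: inv_sum_eq0 t0 _; rewrite -cos_eq.
  transitivity (z1 + z2 + z3 + (z1^-1 + z2^-1 + z3^-1)); first by ring.
  by rewrite s0 s0' addr0.
have w3 : e m ^+ 3 = 1.
  have w0 := e_neq0 m0.
  have w1 : 1 + e m + (e m)^-1 = 0.
    apply: (addrI 1); rewrite addr0 !addrA -tr_eq -!addrA [z1 + _]addrA s0.
    by rewrite [z1^-1 + _]addrA s0' !addr0 mulr1.
  apply/eqP; rewrite -subr_eq0; apply/eqP.
  transitivity (e m * (e m - 1) * (1 + e m + (e m)^-1)); first by field.
  by rewrite w1 mulr0.
have n4 : n = 4%N.
  have := e_dvd n0 t4; rewrite dvdn_divisors // -[divisors 4]/[:: 1; 2; 4]%N !inE.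
  by case/or3P => /eqP nE //; rewrite nE in n2.
have m3 : m = 3%N.
  have := e_dvd m0 w3; rewrite dvdn_divisors // -[divisors 3]/[:: 1; 3]%N !inE.
  by case/orP => /eqP mE //; rewrite mE in m2.
by rewrite n4 m3.
Qed.

(** The second equation expresses 2 cos(2 pi/m) in the N-th cyclotomic field, so
that m divides N and the computation applies. *)
Lemma braid_pair_torsion N P n m z1 z2 z3 : (0 < N)%N -> (12 %| N)%N ->
  cyclotomic_modulus N P -> braid_pair_check N P -> (2 < n)%N -> (2 < m)%N ->
  common_torsion N z1 z2 z3 (e n) ->
  cos_relation z1 z2 z3 (e n) -> trace_relation z1 z2 z3 (e m) -> allowed_pair n m.
Proof.
move=> N0 N12 NP check n2 m2 [tor1 tor2 _ tor_t] [_ p cos_eq] tr_eq.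
have n0 := ltnW (ltnW n2); have m0 := ltnW (ltnW m2).
have prim_z := e_prim N0.
have [z10 z20 z30] := prod3_neq0 p.
have [i z1E] := prim_rootP prim_z tor1; have [j z2E] := prim_rootP prim_z tor2.
have z3E : z3 = (z1 * z2)^-1 by apply: (mulfI (mulf_neq0 z10 z20)); rewrite p divff ?mulf_neq0.
have inv_z k : (k <= 2 * N)%N -> e N ^+ (2 * N - k) = (e N ^+ k)^-1.
  move=> kN; have zu : e N ^+ k != 0 by rewrite expf_neq0 // e_neq0.
  apply: (mulIf zu); rewrite mulVf // -exprD subnK // mulnC exprM.
  by rewrite (prim_expr_order prim_z) expr1n.
have nN : (n %| N)%N by apply: e_dvd.
have mN : (m %| N)%N.
  have wE : e (N * m) ^+ N = e m by apply: e_exp.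
  apply: e_dvd => //; rewrite -{1}wE.
  pose l : seq (int * nat) := (- 2, 0%N) :: [seq (x.1 * y.1, (x.2 + y.2)%N) |
     x <- [:: (1, 0%N); (1, i : nat); (1, j : nat); (1, (2 * N - (i + j))%N)],
     y <- [:: (1, 0%N); (1, (2 * N - i)%N); (1, (2 * N - j)%N); (1, (i + j)%N)]].
  apply: (@cos_in_cyclotomic K N (N * m) _ _ l) => //; first exact: dvdn_mulr.
    by apply: e_prim; rewrite muln_gt0 N0.
  have iN := ltn_ord i; have jN := ltn_ord j.
  rewrite mulKn // wE mulnC e_exp // /l /expsum big_cons -/(expsum _ _) expsumM.
  rewrite /expsum !big_cons !big_nil /= !inv_z //; [|lia..].
  transitivity (2 + e m + (e m)^-1 - 2); last by ring.
  by rewrite -tr_eq z3E z1E z2E -exprD invrK mulrNz !expr0; ring.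
have expE k : (0 < k)%N -> (k %| N)%N -> e k = e N ^+ (N %/ k).
  move=> k0 kN; have Nk0 : (0 < N %/ k)%N by rewrite divn_gt0 // dvdn_leq.
  by have := e_exp Nk0 k0; rewrite divnK.
rewrite z3E z1E z2E (expE n) // in cos_eq; rewrite z3E z1E z2E (expE m) // in tr_eq.
exact: braid_pair_check_sound NP check prim_z (ltn_ord i) (ltn_ord j) nN mN n2 m2 cos_eq tr_eq.
Qed.

Theorem braid_pair_classification n m k z1 z2 z3 : (2 < n)%N -> (2 < m)%N ->
  (0 < k)%N -> z1 ^+ k = 1 -> z2 ^+ k = 1 -> z3 ^+ k = 1 ->
  z1 * z2 * z3 = 1 ->
  z1 + z1^-1 + (z2 + z2^-1) + (z3 + z3^-1) = e n + (e n)^-1 ->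
  trace_relation z1 z2 z3 (e m) -> allowed_pair n m.
Proof.
move=> n2 m2 k0 z1k z2k z3k p cos_eq tr_eq; have n0 := ltnW (ltnW n2).
have rel : cos_relation z1 z2 z3 (e n) by split=> //; exact: e_neq0.
have kn0 : (0 < k * n)%N by rewrite muln_gt0 k0.
have tor : common_torsion (k * n) z1 z2 z3 (e n).
  split; [by rewrite exprM z1k expr1n|by rewrite exprM z2k expr1n|by rewrite exprM z3k expr1n|].
  by rewrite mulnC exprM (prim_expr_order (e_prim n0)) expr1n.
have [D|tor120|[t1 t2 t3 t4]] := cos_relation_torsion (e_prim kn0) tor rel.
- exact: braid_pair_degenerate rel tr_eq D.
- exact: braid_pair_torsion cyclotomic_modulus_120 braid_pair_check_120 n2 m2 tor120 rel tr_eq.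
- apply: braid_pair_torsion cyclotomic_modulus_84 braid_pair_check_84 n2 m2 _ rel tr_eq => //.
  by split; rewrite (exprM _ 42 2) ?t1 ?t2 ?t3 ?t4 expr1n.
Qed.
End BraidPairs.

(** * Traces of a reflection times a root of a reflection *)

Section Spectrum.
Variable C : numClosedFieldType.

Lemma prod3_XsubC (z1 z2 z3 : C) :
  ('X - z1%:P) * ('X - z2%:P) * ('X - z3%:P) =
  'X^3 - (z1 + z2 + z3)%:P * 'X^2 + (z1 * z2 + z1 * z3 + z2 * z3)%:P * 'X
  - (z1 * z2 * z3)%:P.
Proof. by rewrite !(rmorphD, rmorphM) /=; ring. Qed.

Lemma spectrum3 (A : 'M[C]_3) : exists z1 z2 z3,
  [/\ char_poly A = ('X - z1%:P) * ('X - z2%:P) * ('X - z3%:P),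
      \tr A = z1 + z2 + z3, \det A = z1 * z2 * z3
    & [/\ eigenvalue A z1, eigenvalue A z2 & eigenvalue A z3]].
Proof.
have [r] := closed_field_poly_normal (char_poly A).
rewrite (monicP (char_poly_monic A)) scale1r => chiE.
have : size r = 3 by apply: succn_inj; rewrite -(size_char_poly A) chiE size_prod_XsubC.
case: r chiE => [|z1 [|z2 [|z3 [|]]]] // chiE _; exists z1, z2, z3.
have chi3 : char_poly A = ('X - z1%:P) * ('X - z2%:P) * ('X - z3%:P).
  by rewrite chiE !big_cons big_nil mulr1 mulrA.
have coefs := (coefB, coefD, coefCM, coefXn, coefX, coefC).
split=> //; last by rewrite !eigenvalue_root_char chi3 !rootM !root_XsubC !eqxx !orbT.
- apply: oppr_inj; rewrite -(char_poly_trace A isT) chi3 prod3_XsubC !coefs /=; ring.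
- apply: oppr_inj; have := char_poly_det A; rewrite chi3 prod3_XsubC !coefs /= => detE.
  transitivity ((-1) ^+ 3 * \det A); first by ring.
  rewrite -detE; ring.
Qed.

(** For eigenvalues z1, z2, z3 of modulus one and product one, the second
elementary symmetric function z1 z2 + z1 z3 + z2 z3 is the sum of the inverses,
hence the conjugate of the trace. *)
Lemma unitary_Cayley_Hamilton (A : 'M[C]_3) : \det A = 1 ->
  (forall a, eigenvalue A a -> a * a^* = 1) ->
  A ^+ 3 - \tr A *: A ^+ 2 + (\tr A)^* *: A - 1 = 0.
Proof.
move=> det1 unit_eig; have [z1 [z2 [z3 [chi tr_eq det_eq [e1 e2 e3]]]]] := spectrum3 A.
have := Cayley_Hamilton A; rewrite chi prod3_XsubC.
have -> : z1 * z2 + z1 * z3 + z2 * z3 = (\tr A)^*.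
  rewrite tr_eq !rmorphD /= -[RHS]mul1r -det1 det_eq.
  transitivity (z2 * z3 * (z1 * z1^*) + z1 * z3 * (z2 * z2^*) + z1 * z2 * (z3 * z3^*)).
    by rewrite !unit_eig //; ring.
  ring.
rewrite -det_eq -tr_eq det1 !(rmorphB, rmorphD, rmorphM, rmorph1) /=.
by rewrite !horner_mx_C horner_mx_X -!mulmxE !mul_scalar_mx.
Qed.
End Spectrum.

Section Reflections.
Variable C : numClosedFieldType.
Implicit Types (P A : 'M[C]_3) (u c : C).

Definition rank1_projection P : Prop :=
  \tr P = 1 /\ forall A, P * A * P = \tr (P * A) *: P.

(** The normalized lift, with eigenvalues u^2 and u^-1, of the reflection
through the angle 3 arg u with polar projection P. *)
Definition reflection_mx u P : 'M[C]_3 := u^-1 *: (1 + (u ^+ 3 - 1) *: P).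

Lemma rank1_idem P : rank1_projection P -> P * P = P.
Proof. by case=> trP /(_ 1); rewrite !mulr1 trP scale1r. Qed.

Lemma tr_mulC A B : \tr (A * B) = \tr (B * A).
Proof. exact: mxtrace_mulC. Qed.

Lemma tr_reflection_mul u P A :
  \tr (reflection_mx u P * A) = u^-1 * (\tr A + (u ^+ 3 - 1) * \tr (P * A)).
Proof. by rewrite -scalerAl mxtraceZ mulrDl mul1r mxtraceD -scalerAl mxtraceZ. Qed.

Lemma tr_reflection2 u P Q : u != 0 -> \tr P = 1 -> \tr Q = 1 ->
  \tr (reflection_mx u P * reflection_mx u Q) =
  2 * u + u ^- 2 + (u ^+ 3 - 1) ^+ 2 / u ^+ 2 * \tr (P * Q).
Proof.
move=> u0 trP trQ; rewrite tr_reflection_mul [\tr (P * _)]tr_mulC tr_reflection_mul.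
rewrite -[reflection_mx u Q]mulr1 tr_reflection_mul mulr1 trP trQ mxtrace1 tr_mulC.
by field.
Qed.

Lemma conjC_norm1 (a b : C) : a ^+ 2 = b -> b * b^* = 1 -> a * a^* = 1.
Proof.
move=> <- /eqP; rewrite rmorphXn -exprMn -normCK -exprM pexpr_eq1 // => /eqP ->.
by rewrite expr1n.
Qed.

Lemma conjC_root_of_unity (a : C) k : (0 < k)%N -> a ^+ k = 1 -> a * a^* = 1.
Proof.
move=> k0 ak; rewrite -normCK; have /eqP : `|a| ^+ k = 1 by rewrite -normrX ak normr1.
by rewrite pexpr_eq1 // => /eqP ->; rewrite expr1n.
Qed.

Lemma eigenvalue_expr A a k : eigenvalue A a -> A ^+ k = 1 -> a ^+ k = 1.
Proof.
case/eigenvalueP => v vA v0 Ak; have vAk i : v *m A ^+ i = a ^+ i *: v.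
  elim: i => [|i IH]; first by rewrite expr0 scale1r mulmx1.
  by rewrite exprSr -mulmxE mulmxA IH -scalemxAl vA scalerA exprSr.
have := vAk k; rewrite Ak mulmx1 -[v in LHS]scale1r => /eqP.
by rewrite -subr_eq0 -scalerBl scaler_eq0 (negPf v0) orbF subr_eq0 => /eqP.
Qed.

(** The square of an eigenvalue of T is an eigenvalue u^2 or u^-1 of the
reflection; which one depends on whether the projection kills the eigenvector. *)
Lemma reflection_sqrt_eigenvalue u P T a : u * u^* = 1 -> rank1_projection P ->
  T * T = reflection_mx u P -> eigenvalue T a -> a * a^* = 1.
Proof.
move=> uu Pproj TT /eigenvalueP[v vT v0]; have u0 : u != 0.
  by apply: contra_eq_neq uu => ->; rewrite mul0r eq_sym oner_neq0.
have uuV : u^-1 * (u^-1)^* = 1 by rewrite fmorphV -invfM uu invr1.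
have vR : v *m reflection_mx u P = a ^+ 2 *: v.
  by rewrite -TT -mulmxE mulmxA vT -scalemxAl vT scalerA.
pose w := v *m P; have wP : w *m P = w by rewrite -mulmxA mulmxE rank1_idem.
have vwE : u^-1 *: v + (u^-1 * (u ^+ 3 - 1)) *: w = a ^+ 2 *: v.
  by rewrite -vR /reflection_mx -scalemxAr mulmxDr mulmx1 -scalemxAr scalerDr scalerA.
have [w0|w0] := eqVneq w 0.
  apply: conjC_norm1 uuV; apply/eqP; move/eqP: vwE.
  by rewrite w0 scaler0 addr0 -subr_eq0 -scalerBl scaler_eq0 (negPf v0) orbF subr_eq0 eq_sym.
apply: (@conjC_norm1 _ (u ^+ 2)); last by rewrite rmorphXn -exprMn uu expr1n.
have /eqP : u^-1 *: w + (u^-1 * (u ^+ 3 - 1)) *: w = a ^+ 2 *: w.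
  by rewrite (_ : _ *: w = (a ^+ 2 *: v) *m P) ?scalemxAl // -vwE mulmxDl -!scalemxAl wP.
rewrite -scalerDl -subr_eq0 -scalerBl scaler_eq0 (negPf w0) orbF subr_eq0 => /eqP <-.
by field.
Qed.

Lemma mulrP_inv (u : C) : u * u^* = 1 -> u != 0 /\ u^* = u^-1.
Proof.
move=> uu; have u0 : u != 0.
  by apply: contra_eq_neq uu => ->; rewrite mul0r eq_sym oner_neq0.
by split=> //; apply: (mulfI u0); rewrite uu divff.
Qed.

(** T stands for R1^-1 S and Ti for its inverse; the last two hypotheses are the
normalized braid conditions for R1, R3 and for R1, R2 = T R1 Ti. *)
Variables (u X Y : C) (P1 P3 T Ti : 'M[C]_3).
Hypotheses (uu : u * u^* = 1) (u3 : u ^+ 3 != 1) (Xreal : X^* = X).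
Hypotheses (P1_proj : rank1_projection P1) (P3_proj : rank1_projection P3).
Hypotheses (TTi : T * Ti = 1) (TT : T * T = reflection_mx u P3) (detT : \det T = 1).
Hypothesis trTi : \tr (P1 * Ti) = (\tr (P1 * T))^*.
Hypothesis trX : \tr (reflection_mx u P1 * reflection_mx u P3) = u * (2 - X) + u ^- 2.
Hypothesis trY : \tr (reflection_mx u P1 * (T * reflection_mx u P1 * Ti)) =
  u * (2 - Y) + u ^- 2.

Definition unitary_trace_solution (n : nat) : Prop := exists z1 z2 z3 : C,
  [/\ [/\ z1 ^+ n = 1, z2 ^+ n = 1 & z3 ^+ n = 1], z1 * z2 * z3 = 1,
      z1 + z1^-1 + (z2 + z2^-1) + (z3 + z3^-1) = X - 2
    & (1 + z1 + z2 + z3) * (1 + z1^-1 + z2^-1 + z3^-1) = Y].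

Let u0 : u != 0. Proof. by case: (mulrP_inv uu). Qed.
Let uC : u^* = u^-1. Proof. by case: (mulrP_inv uu). Qed.
Let a := u ^+ 3 - 1.
Let a0 : a != 0. Proof. by rewrite subr_eq0. Qed.
Let c := \tr (P1 * P3).
Let kappa := \tr (P1 * T).
Let theta := \tr T.

Let X_E : X = - (a ^+ 2 / u ^+ 3 * c).
Proof.
have := trX; rewrite tr_reflection2 //; [|by case: P1_proj|by case: P3_proj] => e.
apply: (mulIf u0); apply: (addrI (- u * 2 - u ^- 2)).
transitivity (- (u * (2 - X) + u ^- 2)); first by ring.
by rewrite -e -/a -/c; field.
Qed.

Let TiT : Ti * T = 1.
Proof. by rewrite -mulmxE; apply: mulmx1C; rewrite mulmxE. Qed.

Let Y_E : Y = - (a ^+ 2 / u ^+ 3 * (kappa * kappa^*)).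
Proof.
have := trY.
have -> : T * reflection_mx u P1 * Ti = reflection_mx u (T * P1 * Ti).
  by rewrite /reflection_mx -scalerAr -scalerAl mulrDr mulr1 mulrDl TTi -scalerAr -scalerAl.
rewrite tr_reflection2 //; [|by case: P1_proj|]; last first.
  by rewrite tr_mulC mulrA TiT mul1r; case: P1_proj.
have -> : \tr (P1 * (T * P1 * Ti)) = kappa * kappa^*.
  by rewrite !mulrA; case: P1_proj => _ ->; rewrite -scalerAl mxtraceZ trTi.
move=> e; apply: (mulIf u0); apply: (addrI (- u * 2 - u ^- 2)).
transitivity (- (u * (2 - Y) + u ^- 2)); first by ring.
by rewrite -e -/a; field.
Qed.

Let c_real : c^* = c.
Proof.
have aE : a ^+ 2 / u ^+ 3 != 0 by rewrite mulf_neq0 ?expf_neq0 // invr_eq0 expf_neq0.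
have cE : c = - X / (a ^+ 2 / u ^+ 3) by rewrite X_E; field; rewrite u0 a0.
rewrite cE fmorph_div rmorphN /= Xreal; congr (_ / _).
rewrite fmorph_div /a !(rmorphXn, rmorphB, rmorph1) /= uC; field.
exact: u0.
Qed.

Let cayley : T * T * T - theta *: (T * T) + theta^* *: T - 1 = 0.
Proof.
have -> : T * T * T = T ^+ 3 by rewrite exprSr expr2.
rewrite -expr2; apply: unitary_Cayley_Hamilton detT _ => b.
exact: reflection_sqrt_eigenvalue P3_proj TT.
Qed.

Let trS : \tr (reflection_mx u P1 * T) = u^-1 * (theta + a * kappa).
Proof. exact: tr_reflection_mul. Qed.

(** Here T has opposite eigenvalues on the complement of the polar vector of R3.
The Cayley-Hamilton relation becomes T^-1 = R3 + u T - u^-1, whose trace against P1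
expresses the conjugate of tr (P1 T) linearly through tr (P1 T) and tr (P1 P3);
this eliminates tr (P1 T) from the real part of tr S. *)
Lemma opposite_case : theta = - u ->
  let tau := \tr (reflection_mx u P1 * T) in
  tau + tau^* = X - 2 /\ (1 + tau) * (1 + tau^*) = Y.
Proof.
move=> thE tau.
have TiE : Ti = T * T + u *: T - u^-1 *: 1.
  have : (T * T * T - theta *: (T * T) + theta^* *: T - 1) * Ti = 0 by rewrite cayley mul0r.
  rewrite thE rmorphN /= uC !scaleNr opprK !(mulrDl, mulrBl, mulNr) mul1r -!scalerAl.
  rewrite -!(mulrA _ T Ti) !TTi !mulr1 => /eqP; rewrite subr_eq0 => /eqP <-.
  by [].

have kE : kappa^* = u^-1 * (1 + a * c) + u * kappa - u^-1.
  rewrite -trTi TiE mulrBr mulrDr -!scalerAr mulr1 raddfB raddfD /= !mxtraceZ TT.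
  rewrite [\tr (P1 * reflection_mx _ _)]tr_mulC tr_reflection_mul [\tr (P3 * _)]tr_mulC -/c -/a.
  by case: P1_proj => -> _; rewrite mulr1.
have tauE : tau = u^-1 * (- u + a * kappa) by rewrite /tau trS thE.
have aC : a^* = u ^- 3 - 1 by rewrite /a rmorphB rmorph1 rmorphXn /= uC exprVn.
have tauCE : tau^* = u * (- u^-1 + (u ^- 3 - 1) * kappa^*).
  by rewrite tauE rmorphM rmorphD rmorphM rmorphN fmorphV /= uC invrK aC.
rewrite tauCE tauE X_E Y_E kE /a; split; field; exact: u0.
Qed.

(** Multiplying the Cayley-Hamilton relation by 1 - P3, on which T^2 is the
scalar u^-1, gives (u^-1 + d) T = 1 + u^-1 tr T there, where d is the conjugate of
tr T. As d differs from - u^-1, T is a scalar g on this complement of the polar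
vector. *)
Lemma scalar_case : theta != - u -> exists g : C,
  [/\ g * g^* = 1, u = g ^- 2, theta = u + 2 * g & kappa = u * c + g * (1 - c)].
Proof.
move=> thE; pose Q := 1 - P3; pose R3 := reflection_mx u P3.
have P3P3 := rank1_idem P3_proj; have trP3 : \tr P3 = 1 by case: P3_proj.
have QQ : Q * Q = Q by rewrite mulrBl mul1r mulrBr mulr1 P3P3 subrr subr0.
have P3Q : P3 * Q = 0 by rewrite mulrBr mulr1 P3P3 subrr.
have trQ : \tr Q = 2 by rewrite raddfB /= mxtrace1 trP3; ring.
have R3Q : R3 * Q = u^-1 *: Q.
  by rewrite /R3 -scalerAl mulrDl mul1r -scalerAl P3Q scaler0 addr0.
have R3P3 : R3 * P3 = u ^+ 2 *: P3.
  rewrite /R3 -scalerAl mulrDl mul1r -scalerAl P3P3 -{1}[P3]scale1r -scalerDl scalerA.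
  by congr (_ *: _); field.
have TR3 : T * R3 = R3 * T by rewrite /R3 -TT mulrA.
have TP3 : T * P3 = P3 * T.
  have P3E : P3 = (u / a) *: R3 - a^-1 *: 1.
    rewrite /R3 /reflection_mx -/a scalerA (_ : u / a / u = a^-1); last by field; rewrite a0 u0.
    by rewrite scalerDr addrAC subrr add0r scalerA mulVf // scale1r.
  have comm A : T * A = A * T -> GRing.comm T ((u / a) *: A - a^-1 *: 1).
    by move=> TA; rewrite /GRing.comm mulrBr mulrBl -!scalerAr -!scalerAl TA mulr1 mul1r.
  by rewrite P3E; exact: comm.
pose l := \tr (P3 * T).
have TP3l : T * P3 = l *: P3.
  by rewrite -{1}P3P3 mulrA TP3; case: P3_proj => _ ->.
have d0 : u^-1 + theta^* != 0.
  apply: contra_neq thE => /eqP; rewrite addrC addr_eq0 => /eqP thC.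
  by rewrite -[theta]conjCK thC rmorphN fmorphV /= uC invrK.
pose g := (1 + theta / u) / (u^-1 + theta^*).
have cayleyM A : T * R3 * A - theta *: (R3 * A) + theta^* *: (T * A) - A = 0.
  rewrite -[RHS](mul0r A) -cayley -(mulrA T T T) TT -/R3.
  by rewrite !(mulrDl, mulNr) mul1r -!scalerAl.
have TQg : T * Q = g *: Q.
  apply: (scalerI d0); rewrite scalerA mulrCA divff // mulr1.
  have := cayleyM Q; rewrite -mulrA R3Q -scalerAr scalerA => /eqP.
  rewrite subr_eq0 addrAC -scalerDl subr_eq => /eqP ->.
  by rewrite scalerDl scale1r.
have TE : T = l *: P3 + g *: Q by rewrite -TP3l -TQg -mulrDr addrC subrK mulr1.
have lu : l ^+ 2 = u ^+ 2.
  have := congr1 mxtrace R3P3; rewrite /R3 -TT -mulrA TP3l -scalerAr TP3l scalerA.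
  by rewrite !mxtraceZ trP3 !mulr1 -expr2.
have gu : g ^+ 2 = u^-1.
  have := congr1 mxtrace R3Q; rewrite /R3 -TT -mulrA TQg -scalerAr TQg scalerA.
  by rewrite !mxtraceZ trQ -expr2 => /mulIf; apply; rewrite pnatr_eq0.
have thlg : theta = l + 2 * g by rewrite /theta TE raddfD /= !mxtraceZ trP3 trQ; ring.
have gg : g * g^* = 1.
  by apply: conjC_norm1 gu _; rewrite fmorphV -invfM uu invr1.
have ll : l * l^* = 1.
  by apply: conjC_norm1 lu _; rewrite rmorphXn -exprMn uu expr1n.
have [g0 gC] := mulrP_inv gg; have [l0 lC] := mulrP_inv ll.
have lgg : l * g ^+ 2 = 1.
  have := congr1 mxtrace (cayleyM P3).
  rewrite -mulrA R3P3 -scalerAr TP3l !(raddfB, raddfD) /= !mxtraceZ trP3 raddf0 !mulr1 -lu.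
  rewrite thlg !rmorphD rmorphM rmorph_nat /= lC gC => e.
  apply/eqP; rewrite eq_sym -subr_eq0; apply/eqP.
  apply: (@mulfI _ (2 * l / g)); first by rewrite !mulf_neq0 ?invr_eq0 ?pnatr_eq0.
  by rewrite mulr0 -e; field; rewrite l0 g0.
have lE : l = u by rewrite -[u]invrK -gu; apply: (mulIf (expf_neq0 2 g0));
  rewrite lgg mulVf // expf_neq0.
exists g; split => //; first by rewrite gu invrK.
  by rewrite thlg lE.
rewrite /kappa TE mulrDr raddfD /= -!scalerAr !mxtraceZ -/c lE mulrBr mulr1 raddfB /=.
by case: P1_proj => -> _.
Qed.

(** The first identity says that g^3 is a root of the characteristic polynomial
of S. The vectors orthogonal to both polar vectors are eigenvectors of R1 and T
for u^-1 = g^2 and g, which is where this eigenvalue comes from. The other two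
are the required equations for the trace 2 g^3 - tr S of the triple in which
the remaining two eigenvalues have changed sign. *)
Lemma scalar_case_identities g : g * g^* = 1 -> u = g ^- 2 -> theta = u + 2 * g ->
  kappa = u * c + g * (1 - c) ->
  let tau := \tr (reflection_mx u P1 * T) in
  [/\ (g ^+ 3) ^+ 3 - tau * (g ^+ 3) ^+ 2 + tau^* * g ^+ 3 - 1 = 0,
      2 * (g ^+ 3 + g ^- 3) - (tau + tau^*) = X - 2
    & (1 + 2 * g ^+ 3 - tau) * (1 + 2 * g ^- 3 - tau^*) = Y].
Proof.
move=> gg uE thE kE tau; have [g0 gC] := mulrP_inv gg.
have g6 : 1 - g ^+ 6 != 0.
  apply: contra_neq u3 => /eqP; rewrite subr_eq0 uE => /eqP g6.
  by rewrite exprVn -exprM -g6 invr1.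
have kC : kappa^* = u^-1 * c + g^-1 * (1 - c).
  by rewrite kE rmorphD !rmorphM rmorphB rmorph1 /= uC gC c_real.
have tauE : tau = g ^+ 2 * (g ^- 2 + 2 * g + (g ^- 6 - 1) * (g ^- 2 * c + g * (1 - c))).
  by rewrite /tau trS thE kE /a uE; field.
have tauC : tau^* = g ^- 2 * (g ^+ 2 + 2 * g^-1 + (g ^+ 6 - 1) * (g ^+ 2 * c + g^-1 * (1 - c))).
  rewrite tauE !(rmorphD, rmorphM, rmorphN, rmorph1, rmorph_nat, fmorphV, rmorphXn) /= gC c_real.
  by field.
by rewrite X_E Y_E kC kE tauC tauE /a uE; split; field.
Qed.

Theorem unitary_traces (n : nat) : (0 < n)%N -> \det (reflection_mx u P1 * T) = 1 ->
  (reflection_mx u P1 * T) ^+ n = 1 -> unitary_trace_solution (2 * n).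
Proof.
move=> n0 detS Sn; set S := reflection_mx u P1 * T in detS Sn.
have [z1 [z2 [z3 [_ tr_eq det_eq [eig1 eig2 eig3]]]]] := spectrum3 S.
have z1n := eigenvalue_expr eig1 Sn; have z2n := eigenvalue_expr eig2 Sn.
have z3n := eigenvalue_expr eig3 Sn; rewrite detS in det_eq.
have inv (z : C) : z ^+ n = 1 -> z^* = z^-1.
  by move=> zn; case: (mulrP_inv (conjC_root_of_unity n0 zn)).
have sq (z : C) : z ^+ n = 1 -> z ^+ (2 * n) = 1.
  by move=> zn; rewrite mulnC exprM zn expr1n.
have sqN (z : C) : z ^+ n = 1 -> (- z) ^+ (2 * n) = 1.
  by move=> zn; rewrite exprM sqrrN -exprM sq.
have trC : (\tr S)^* = z1^-1 + z2^-1 + z3^-1 by rewrite tr_eq !rmorphD /= !inv.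
have [thE|thE] := eqVneq theta (- u).
  have [e1 e2] := opposite_case thE; rewrite -/S in e1 e2.
  exists z1, z2, z3; split; [by split; apply: sq|by []| |].
    by rewrite -e1 trC tr_eq; ring.
  by rewrite -e2 trC tr_eq !addrA.
have [g [gg uE thgE kE]] := scalar_case thE.
have [e0 e1 e2] := scalar_case_identities gg uE thgE kE; rewrite -/S in e0 e1 e2.
have solve y1 y2 y3 : y1 ^+ n = 1 -> y2 ^+ n = 1 -> y3 ^+ n = 1 ->
    1 = y1 * y2 * y3 -> \tr S = y1 + y2 + y3 -> (\tr S)^* = y1^-1 + y2^-1 + y3^-1 ->
    g ^+ 3 = y1 -> unitary_trace_solution (2 * n).
  move=> y1n y2n y3n p tE tCE gE; exists y1, (- y2), (- y3); split.
  - by split; [exact: sq|exact: sqN|exact: sqN].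
  - by rewrite mulrN mulrN mulNr opprK.
  - by rewrite -e1 gE tCE tE !invrN; ring.
  - by rewrite -e2 gE tCE tE !invrN; congr (_ * _); ring.
have z_neq0 (z : C) : z ^+ n = 1 -> z != 0.
  by move=> zn; case: (mulrP_inv (conjC_root_of_unity n0 zn)).
have : (g ^+ 3 - z1) * (g ^+ 3 - z2) * (g ^+ 3 - z3) = 0.
  rewrite -e0 trC tr_eq.
  have -> : z1^-1 + z2^-1 + z3^-1 = z2 * z3 + z1 * z3 + z1 * z2.
    by rewrite -[LHS]mul1r det_eq; field; rewrite !z_neq0.
  by rewrite det_eq; ring.
move/eqP; rewrite !mulf_eq0 !subr_eq0 => /orP[/orP[]|] /eqP gE.
- exact: (solve z1 z2 z3).
- by apply: (solve z2 z1 z3) => //; rewrite ?det_eq ?trC ?tr_eq; ring.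
- by apply: (solve z3 z2 z1) => //; rewrite ?det_eq ?trC ?tr_eq; ring.
Qed.
End Reflections.

Local Open Scope classical_set_scope.
Local Open Scope complex_scope.
Local Open Scope ring_scope.

(** * The exponential and the Hermitian form *)

Section CExp.
Variable R : realType.
Implicit Types (s t : R).

Lemma cexpD s t : cexp (s + t) = cexp s * cexp t.
Proof.
rewrite /cexp cosD sinD; apply/eqP; rewrite eq_complex /= eqxx /=.
by apply/eqP; ring.
Qed.

Lemma cexp0 : cexp (0 : R) = 1.
Proof. by rewrite /cexp cos0 sin0. Qed.

Lemma cexp_mulrn t n : cexp (t *+ n) = cexp t ^+ n.
Proof. by elim: n => [|n IH]; rewrite ?mulr0n ?cexp0 // mulrS exprS cexpD IH. Qed.

Lemma conj_cexp t : (cexp t)^* = cexp (- t).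
Proof. by rewrite /cexp cosN sinN. Qed.

Lemma cexp_unit t : cexp t * (cexp t)^* = 1.
Proof. by rewrite conj_cexp -cexpD subrr cexp0. Qed.

Lemma cexpN t : cexp (- t) = (cexp t)^-1.
Proof. by rewrite -conj_cexp; case: (mulrP_inv (cexp_unit t)). Qed.

Lemma cexp_addV t : cexp t + (cexp t)^-1 = (2 * cos t)%:C.
Proof.
rewrite -cexpN /cexp cosN sinN; apply/eqP; rewrite eq_complex /= subrr eqxx andbT.
by apply/eqP; ring.
Qed.

Definition unity_root (n : nat) : R[i] := cexp (2 * pi / n%:R).

Lemma cexp_neq1 t : 0 < t -> t < 2 * pi -> cexp t != 1.
Proof.
move=> t0 t2; rewrite /cexp eq_complex /=; apply/negP => /andP[/eqP cos1 _]; move: cos1.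
have -> : t = t / 2 + t / 2 by field.
rewrite cosD -!expr2 => cos1.
have : sin (t / 2) ^+ 2 = 0.
  have := cos2Dsin2 (t / 2); lra.
move=> /eqP; rewrite sqrf_eq0 gt_eqF // sin_gt0_pi //; apply/andP; split; lra.
Qed.

Lemma unity_root_exp a b : (0 < a)%N -> (0 < b)%N ->
  unity_root (a * b) ^+ a = unity_root b.
Proof.
move=> a0 b0; rewrite /unity_root -cexp_mulrn; congr (cexp _).
have a0' : a%:R != 0 :> R by rewrite pnatr_eq0 -lt0n.
have b0' : b%:R != 0 :> R by rewrite pnatr_eq0 -lt0n.
by rewrite natrM -mulr_natr; field; rewrite a0' b0'.
Qed.

Lemma unity_root_primitive n : (0 < n)%N -> n.-primitive_root (unity_root n).
Proof.
move=> n0; have n0' : 0 < n%:R :> R by rewrite ltr0n.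
have ex k : unity_root n ^+ k = cexp (2 * pi / n%:R * k%:R).
  by rewrite -cexp_mulrn mulr_natr.
have en1 : unity_root n ^+ n = 1.
  by rewrite ex divfK ?gt_eqF // [2 * pi]mulrC mulr_natr /cexp cos2pi sin2pi.
have [k prim_k k_n] := prim_order_exists n0 en1.
suff kn : k = n by rewrite -{1}kn.
apply/eqP; rewrite eqn_leq dvdn_leq //= leqNgt; apply/negP => k_lt_n.
have k0 := prim_order_gt0 prim_k; have k0' : 0 < k%:R :> R by rewrite ltr0n.
have := prim_expr_order prim_k; rewrite ex; apply/eqP/cexp_neq1.
  by rewrite !mulr_gt0 ?pi_gt0 ?invr_gt0.
by rewrite -mulrA gtr_pMr ?mulr_gt0 ?pi_gt0 // mulrC ltr_pdivrMr // mul1r ltr_nat.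
Qed.
End CExp.

Section Hermitian.
Variable R : realType.
Implicit Types (v z w : 'cV[R[i]]_3) (A T : 'M[R[i]]_3).

(** The linear form herm _ v as a row vector. *)
Definition herm_dual v : 'rV[R[i]]_3 :=
  \row_j (if j == ord_max then - (v j 0)^* else (v j 0)^*).

Lemma herm_dualE z v : herm_dual v *m z = (herm z v)%:M.
Proof.
apply/matrixP => i j; rewrite !ord1 !mxE eqxx mulr1n !big_ord_recr big_ord0 /= !mxE /= /herm.
have -> : widen_ord (leqnSn 2) (widen_ord (leqnSn 1) ord_max) = ord0 by apply/val_inj.
have -> : widen_ord (leqnSn 2) ord_max = 1 by apply/val_inj.
by ring.
Qed.

Lemma herm_conj z w : (herm z w)^* = herm w z.
Proof.
rewrite /herm !(rmorphB, rmorphD, rmorphM) /= !conjCK.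
by rewrite ![(_)^* * _]mulrC.
Qed.

Definition polar_projection v : 'M[R[i]]_3 := (herm v v)^-1 *: (v *m herm_dual v).

Lemma polar_projection_mul v z :
  polar_projection v *m z = (herm z v / herm v v) *: v.
Proof.
by rewrite -scalemxAl -mulmxA herm_dualE mul_mx_scalar scalerA mulrC.
Qed.

Lemma tr_polar_projection v A :
  \tr (polar_projection v * A) = herm (A *m v) v / herm v v.
Proof.
rewrite -mulmxE -scalemxAl mxtraceZ -mulmxA mxtrace_mulC -mulmxA herm_dualE.
by rewrite mxtrace_scalar mulrC.
Qed.

Lemma polar_projection_rank1 v : polar v -> rank1_projection (polar_projection v).
Proof.
move=> v0; have vv : herm v v != 0 by rewrite gt_eqF.
split; first by rewrite -[polar_projection v]mulr1 tr_polar_projection mul1mx divff.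
move=> A; rewrite tr_polar_projection /polar_projection -scalerAl -scalerAr -scalerAl.
rewrite !scalerA -!mulmxE mulmxA -[v *m _ *m A *m v]mulmxA -[v *m _ *m _]mulmxA.
rewrite herm_dualE mul_mx_scalar -scalemxAl scalerA; congr (_ *: _).
by field.
Qed.

(** tr (P A) is the matrix coefficient herm (A v) v / herm v v, and the adjoint
of an isometry is its inverse. *)
Lemma isometry_tr_inv v T Ti : T * Ti = 1 ->
  (forall z w, herm (T *m z) (T *m w) = herm z w) ->
  \tr (polar_projection v * Ti) = (\tr (polar_projection v * T))^*.
Proof.
move=> TTi iso; rewrite !tr_polar_projection fmorph_div /= !herm_conj -(iso (Ti *m v)).
by rewrite mulmxA mulmxE TTi mul1mx.
Qed.

Lemma eq_mulmx_cV A T : (forall z, A *m z = T *m z) -> A = T.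
Proof.
move=> AT; apply/matrixP => i j; have := AT (delta_mx j 0).
by rewrite -!colE => /matrixP/(_ i 0); rewrite !mxE.
Qed.

Definition reflection_unit (p : nat) : R[i] := cexp (2 * pi / (3 * p%:R) : R).

(** The scalar exp(- 2 pi i/3p) is u^-1 and the rotation exp(2 pi i/p) is u^3. *)
Lemma creflection_mx p C A : (0 < p)%N -> is_creflection p C A ->
  exists v, polar v /\ A = reflection_mx (reflection_unit p) (polar_projection v).
Proof.
move=> p0 [v [v0 _ AE]]; exists v; split=> //; apply: eq_mulmx_cV => z; rewrite AE.
have p0' : p%:R != 0 :> R by rewrite pnatr_eq0 -lt0n.
rewrite /reflection_mx -scalemxAl mulmxDl mul1mx -scalemxAl polar_projection_mul.
rewrite /creflection scalerA; congr (_ *: (_ + (_ - 1) * _ *: _)).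
  by rewrite cexpN; congr (cexp _)^-1; field.
by rewrite -cexp_mulrn -mulr_natr; congr (cexp _); field.
Qed.
End Hermitian.

Lemma braid_traceE (R : realType) p n : let u := reflection_unit R p in
  braid_trace R p n = u * (2 - (4 * cos (pi / n%:R) ^+ 2)%:C) + u ^- 2.
Proof.
rewrite /braid_trace /reflection_unit conj_cexp cexpN exprVn; congr (_ * _ + _).
by rewrite rmorphB /= rmorph_nat.
Qed.

Lemma unity_root_addV (R : realType) n :
  unity_root R n + (unity_root R n)^-1 = (4 * cos (pi / n%:R) ^+ 2)%:C - 2.
Proof.
rewrite /unity_root cexp_addV.
have -> : 2 * pi / n%:R = pi / n%:R + pi / n%:R :> R by rewrite -mulrA mulr_natl mulr2n.
rewrite cosD -!expr2 -[2]/(2%:R) -(rmorph_nat (real_complex R)) -rmorphB /=.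
by rewrite sin2cos2; congr (_%:C); ring.
Qed.

Local Open Scope classical_set_scope.
Local Open Scope ring_scope.
Local Open Scope complex_scope.

Theorem theorem2p4 (R : realType) (p : nat) (hp : (2 <= p)%N)
    (C1 C2 C3 : set 'cV[R[i]]_3) (R1 R2 R3 : 'M[R[i]]_3)
    (hR1 : R1 \in @SU21 R) (hR2 : R2 \in @SU21 R) (hR3 : R3 \in @SU21 R)
    (hC1 : is_creflection p C1 R1) (hC2 : is_creflection p C2 R2)
    (hC3 : is_creflection p C3 R3)
    (hS : exists S : 'M[R[i]]_3, S \in @SU21 R /\
      [/\ S * R1 * S^-1 = R1 * R2 * R1^-1,
          S * R2 * S^-1 = R1 * R3 * R1 * R3^-1 * R1^-1,
          S * R3 * S^-1 = R1 * R3 * R1^-1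
        & S ^+ 2 = R1 * R2 * R3])
    (m n : nat) (hm : (3 <= m)%N) (hn : (3 <= n)%N)
    (hbr13 : normalized_br p R1 R3 n) (hbr12 : normalized_br p R1 R2 m)
    (hfin : finite_order (R1 * R2 * R3)) :
  (n, m) \in [:: (3, 4); (3, 5); (4, 3); (5, 4); (8, 6)]%N \/
  exists2 k, (3 <= k)%N & (n, m) = (k, k).
Proof.
have p0 : (0 < p)%N by exact: ltnW.
have [S [/set_mem[detS isoS] [SR1 _ _ S2]]] := hS.
have [detR1 isoR1] := set_mem hR1; have [detR2 isoR2] := set_mem hR2.
have unitM (A : 'M[R[i]]_3) : \det A = 1 -> A \is a GRing.unit.
  by move=> detA; rewrite unitmxE detA unitr1.
have uR1 := unitM _ detR1; have uR2 := unitM _ detR2; have uS := unitM _ detS.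
pose T := R1^-1 * S; pose Ti := S^-1 * R1.
have R1T : R1 * T = S by rewrite /T mulrA divrr ?mul1r.
have TTi : T * Ti = 1 by rewrite /T /Ti mulrA mulrK // mulVr.
have TR1 : T * R1 * Ti = R2.
  by rewrite /T /Ti -!mulrA [S * _]mulrA [_ * (S^-1 * _)]mulrA SR1 -!mulrA mulVr // mulr1 mulKr.
have TiT : Ti * T = 1 by rewrite /T /Ti mulrA mulrK // mulVr.
clearbody T Ti.
have TT : T * T = R3.
  apply: (mulrI uR2); apply: (mulrI uR1); rewrite [RHS]mulrA -S2 expr2.
  by rewrite -TR1 -!mulrA [Ti * (T * T)]mulrA TiT mul1r R1T mulrA R1T.
have isoT z w : herm (T *m z) (T *m w) = herm z w.
  by rewrite -isoR1 !mulmxA !mulmxE R1T isoS.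
have [v1 [pol1 R1E]] := creflection_mx p0 hC1.
have [v3 [pol3 R3E]] := creflection_mx p0 hC3.
pose u := reflection_unit R p.
have uu : u * u^* = 1 by exact: cexp_unit.
have u3 : u ^+ 3 != 1.
  have -> : u ^+ 3 = unity_root R p.
    rewrite /u /reflection_unit /unity_root -cexp_mulrn -mulr_natr; congr (cexp _).
    by field; rewrite pnatr_eq0 -lt0n.
  by rewrite -(expr1 (unity_root R p)) -(prim_order_dvd (unity_root_primitive R p0)) dvdn1 gtn_eqF.
have detT : \det T = 1.
  by rewrite -[LHS]mul1r -[X in X * _]detR1 -det_mulmx mulmxE R1T.
pose X n : R[i] := (4 * cos (pi / n%:R) ^+ 2)%:C.
have Xreal : (X n)^*%R = X n by exact: conjc_real.
have [_ trX] := hbr13; have [_ trY] := hbr12.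
have [k k0 Sk] := hfin.
have S2k : (R1 * T) ^+ (2 * k) = 1 by rewrite R1T exprM S2.
have detS' : \det (R1 * T) = 1 by rewrite R1T.
rewrite !braid_traceE -/u -/(X n) -/(X m) -TR1 R3E R1E in trX trY.
rewrite R3E in TT; rewrite R1E in S2k detS'.
have kk0 : (0 < 2 * k)%N by rewrite muln_gt0 k0.
have [z1 [z2 [z3 [[z1k z2k z3k] z123 cos_eq tr_eq]]]] := unitary_traces uu u3 Xreal
  (polar_projection_rank1 pol1) (polar_projection_rank1 pol3) TTi TT detT
  (isometry_tr_inv v1 TTi isoT) trX trY kk0 detS' S2k.
have : allowed_pair n m.
  apply: (braid_pair_classification (@unity_root_primitive R) (@unity_root_exp R)
    hn hm _ z1k z2k z3k z123); first by rewrite muln_gt0 kk0.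
    by rewrite unity_root_addV.
  by rewrite /trace_relation tr_eq -addrA unity_root_addV addrC subrK.
case/orP => [/eqP <-|]; [by right; exists n|by left].
Qed.
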